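(* Let $k$ be an algebraically closed field, let $X$ and $Y$ be schemes of finite type over $k$, and let $f:X\to Y$ be a morphism of schemes over $k$. If the induced morphism $f_m:X_m\to Y_m$ of $m$-jet schemes is an isomorphism for some $m\in\mathbb{N}\cup\{\infty\}$, then $f$ is an isomorphism.
   Context: For a scheme $X$ of finite type over $k$ and $m\in\mathbb{N}$, the $m$-jet scheme $X_m$ is the $k$-scheme representing the functor $Z\mapsto \operatorname{Hom}_k(Z\times_{\operatorname{Spec} k}\operatorname{Spec} k[t]/(t^{m+1}),X)$ on $k$-schemes. For $m'<m$ in $\mathbb{N}$, reduction modulo $t^{m'+1}$ gives the truncation morphism $X_m\to X_{m'}$, and $X_\infty=\varprojlim_m X_m$ is the projective limit (the arc space). A morphism $f:X\to Y$ over $k$ induces $f_m:X_m\to Y_m$ by composing jets with $f$ (for $m=\infty$, $f_\infty$ is the projective limit of the $f_m$, $m\in\mathbb{N}$). *)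

(* Defs.v *)
From HB Require Import structures.
From mathcomp Require Import all_boot all_order all_algebra ring.
From mathcomp Require Import boolp classical_sets topology_structure.
Set Implicit Arguments.
Unset Strict Implicit.
Unset Printing Implicit Defensive.
Import GRing.Theory.
Local Open Scope ring_scope.
Local Open Scope classical_set_scope.
Local Open Scope quotient_scope.

(** * Locally ringed spaces *)

(* Primitive projections make [preim] below commute definitionally with
   composition of morphisms. *)
#[projections(primitive)]
Record opens (X : topologicalType) := Opens {
  oset :> set X;
  oset_open : open oset }.
Arguments Opens {X} oset oset_open.

Definition pts {X : topologicalType} (U : opens X) := {p : X | oset U p}.

Definition openT_ {X : topologicalType} : opens X := Opens setT openT.

Definition openI_ {X : topologicalType} (U V : opens X) : opens X :=
  Opens (U `&` V) (openI (oset_open U) (oset_open V)).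

(* Rings of sections are [comPzRingType]s because the zero ring must be
   allowed (sections over the empty set). *)
Record ringed_space := RingedSpace {
  rs_space :> topologicalType;
  sec : opens rs_space -> comPzRingType;
  res : forall U V : opens rs_space, V `<=` U -> {rmorphism sec U -> sec V};
  res_id : forall (U : opens rs_space) (h : U `<=` U) s, res h s = s;
  res_comp : forall (U V W : opens rs_space) (h1 : V `<=` U) (h2 : W `<=` V)
      (h3 : W `<=` U) s,
    res h2 (res h1 s) = res h3 s;
  res_glue : forall (U : opens rs_space) (I : Type) (V : I -> opens rs_space)
      (VU : forall i, V i `<=` U),
    U `<=` \bigcup_i V i ->
    forall s : forall i, sec (V i),
    (forall i j (W : opens rs_space) (hi : W `<=` V i) (hj : W `<=` V j),
       res hi (s i) = res hj (s j)) ->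
    exists! t : sec U, forall i, res (VU i) t = s i }.

(* The germ of [s] at [x] is a unit of the stalk at [x]. *)
Definition germ_unit (X : ringed_space) (x : X) (U : opens X) (s : sec U) :=
  exists (V : opens X) (h : V `<=` U) (t : sec V), oset V x /\ res h s * t = 1.

(* Every stalk is a local ring: 1 <> 0 in the stalk, and the nonunits of the
   stalk are closed under addition.  Two germs at [x] always have
   representatives over a common open set. *)
Definition locally_ringed (X : ringed_space) : Prop :=
  forall (x : X) (U : opens X), oset U x ->
    (1 : sec U) <> 0 /\
    (forall s t : sec U, ~ germ_unit x s -> ~ germ_unit x t ->
       ~ germ_unit x (s + t)).

Definition preim (X Y : topologicalType) (f : X -> Y)
    (fc : forall V, open V -> open (f @^-1` V)) (V : opens Y) : opens X :=
  Opens (f @^-1` V) (fc V (oset_open V)).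

(* Morphisms of locally ringed spaces; [mor_local] says that the induced maps
   on stalks are local homomorphisms. *)
Record mor (X Y : ringed_space) := Mor {
  mor_fun :> X -> Y;
  mor_cont : forall V, open V -> open (mor_fun @^-1` V);
  mor_sec : forall V : opens Y, {rmorphism sec V -> sec (preim mor_cont V)};
  mor_res : forall (U V : opens Y) (h : V `<=` U)
      (h' : preim mor_cont V `<=` preim mor_cont U) (s : sec U),
    res h' (mor_sec U s) = mor_sec V (res h s);
  mor_local : forall (x : X) (V : opens Y) (s : sec V), oset V (mor_fun x) ->
    germ_unit x (mor_sec V s) -> germ_unit (mor_fun x) s }.

Section Category.

Program Definition idm (X : ringed_space) : mor X X :=
  @Mor X X (fun x => x) (fun V oV => oV)
    (fun V => @idfun (sec V) : {rmorphism sec V -> sec V}) _ _.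
Next Obligation.
by move=> X U V h h' s /=; congr (res _ _); apply: Prop_irrelevance.
Qed.
Next Obligation. by []. Qed.

Variables (X Y Z : ringed_space) (g : mor Y Z) (f : mor X Y).

Definition comp_cont (V : set Z) (oV : open V) : open (f @^-1` (g @^-1` V)) :=
  mor_cont f (mor_cont g oV).

Program Definition compm : mor X Z :=
  @Mor X Z (fun x => g (f x)) comp_cont
    (fun V => mor_sec f (preim (mor_cont g) V) \o mor_sec g V
       : {rmorphism sec V -> sec (preim (mor_cont f) (preim (mor_cont g) V))})
    _ _.
Next Obligation.
move=> U V h h' s /=.
have h2 : preim (mor_cont g) V `<=` preim (mor_cont g) U by move=> y /h.
by rewrite (mor_res h2) (mor_res h).
Qed.
Next Obligation.
move=> x V s Vx u; apply: (mor_local (m := g) (V := V)) => //.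
exact: (mor_local (m := f) (V := preim (mor_cont g) V)).
Qed.

End Category.

(* An isomorphism onto an open subspace: a homeomorphism onto an open subset
   such that the comorphism is bijective on the open subsets of the image. *)
Definition open_immersion (X Y : ringed_space) (j : mor X Y) : Prop :=
  [/\ injective j,
      (forall U, open U -> open (j @` U)) &
      (forall V : opens Y, V `<=` range j -> bijective (mor_sec j V))].

(** * The spectrum of a commutative ring *)

Record prime_ideal (A : comPzRingType) := PrimeIdeal {
  pideal :> set A;
  pideal0 : pideal 0;
  pidealD : forall a b, pideal a -> pideal b -> pideal (a + b);
  pidealM : forall a b, pideal b -> pideal (a * b);
  pideal1 : ~ pideal 1;
  pideal_prime : forall a b, pideal (a * b) -> pideal a \/ pideal b }.

Lemma prime_ideal_ext (A : comPzRingType) (p q : prime_ideal A) :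
  pideal p = pideal q -> p = q.
Proof.
case: p q => [p p0 pD pM p1 pP] [q q0 qD qM q1 qP] /= E; subst q.
by congr PrimeIdeal; apply: Prop_irrelevance.
Qed.

HB.instance Definition _ (A : comPzRingType) := gen_eqMixin (prime_ideal A).
HB.instance Definition _ (A : comPzRingType) := gen_choiceMixin (prime_ideal A).

Section Zariski.
Variable A : comPzRingType.

(* The closed sets are the V(S) = {p | S is contained in p}. *)
Definition zariski_open (U : set (prime_ideal A)) : Prop :=
  exists S : set A, U = [set p | ~ (S `<=` pideal p)].

Lemma zariski_openT : zariski_open setT.
Proof.
exists [set 1]; apply/seteqP; split=> // p _ /= h.
by apply: (@pideal1 _ p); apply: h.
Qed.

Lemma zariski_openI : setI_closed zariski_open.
Proof.
move=> _ _ [S ->] [T ->].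
exists [set x | exists a b, [/\ S a, T b & x = a * b]].
apply/seteqP; split=> p /=.
  move=> [/existsNP[a /not_implyP[Sa pa]] /existsNP[b /not_implyP[Tb pb]]] h.
  have /pideal_prime[] // : pideal p (a * b) by apply: h; exists a, b.
move=> h; split=> h'; apply: h => _ [a [b [Sa Tb ->]]].
  by rewrite mulrC; apply: pidealM; apply: h'.
by apply: pidealM; apply: h'.
Qed.

Lemma zariski_open_bigU (I : Type) (f : I -> set (prime_ideal A)) :
  (forall i, zariski_open (f i)) -> zariski_open (\bigcup_i f i).
Proof.
move=> h; exists [set a | exists2 S : set A, S a &
  exists i, f i = [set p | ~ (S `<=` pideal p)]].
apply/seteqP; split=> p /=.
  move=> [i _ fip]; case: (h i) => S E; move: (fip); rewrite E /= => np hp.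
  by apply: np => a Sa; apply: hp; exists S => //; exists i.
move=> /existsNP[a /not_implyP[[S Sa [i E]] pa]]; exists i => //.
by rewrite E /= => hp; apply: pa; apply: hp.
Qed.

HB.instance Definition _ := isOpenTopological.Build (prime_ideal A)
  zariski_openT zariski_openI zariski_open_bigU.

Lemma zariski_openE (U : set (prime_ideal A)) : open U <-> zariski_open U.
Proof.
split; last first.
  by move=> zU; rewrite openE => p Up; exists U; split.
rewrite openE => h.
have -> : U = \bigcup_(i : {V | zariski_open V /\ V `<=` U}) sval i.
  apply/seteqP; split=> p; last by move=> [[V [zV VU]] _ /= /VU].
  by move=> /h[V [zV Vp VU]]; exists (exist _ V (conj zV VU)).
by apply: zariski_open_bigU => -[V []].
Qed.

End Zariski.

Section Localization.
Variables (A : comPzRingType) (p : prime_ideal A).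

Definition denom (s : A) : bool := `[< ~ pideal p s >].

Lemma denomP s : reflect (~ pideal p s) (denom s).
Proof. exact: asboolP. Qed.

Lemma denom1 : denom 1.
Proof. by apply/denomP/pideal1. Qed.

Lemma denomM s t : denom s -> denom t -> denom (s * t).
Proof.
by move=> /denomP hs /denomP ht; apply/denomP => /pideal_prime[].
Qed.

Definition prefrac := {x : A * A | denom x.2}.

Definition prefrac_eqv (x y : prefrac) : bool :=
  `[< exists2 u, denom u &
      u * ((val x).1 * (val y).2) = u * ((val y).1 * (val x).2) >].

Lemma prefrac_eqv_refl : reflexive prefrac_eqv.
Proof. by move=> x; apply/asboolP; exists 1 => //; apply: denom1. Qed.

Lemma prefrac_eqv_sym : symmetric prefrac_eqv.
Proof.
by move=> x y; apply/asboolP/asboolP => -[u hu e]; exists u.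
Qed.

Lemma prefrac_eqv_trans : transitive prefrac_eqv.
Proof.
move=> y x z /asboolP[u hu e] /asboolP[v hv e']; apply/asboolP.
exists (u * v * (val y).2); first by rewrite !denomM // (valP y).
transitivity (v * (val z).2 * (u * ((val x).1 * (val y).2))); first by ring.
rewrite e; transitivity (u * (val x).2 * (v * ((val y).1 * (val z).2))).
  by ring.
by rewrite e'; ring.
Qed.

Canonical prefrac_equiv := EquivRel prefrac_eqv
  prefrac_eqv_refl prefrac_eqv_sym prefrac_eqv_trans.

(* The localization A_p. *)
Definition loc := {eq_quot prefrac_equiv}.
HB.instance Definition _ : EqQuotient _ prefrac_equiv loc := EqQuotient.on loc.
HB.instance Definition _ := Choice.on loc.

Definition prefrac1 : prefrac := exist _ (0, 1) denom1.

(* The fraction a / s; the value for [s] in [p] is irrelevant. *)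
Definition frac (a s : A) : loc := \pi_loc (insubd prefrac1 (a, s)).

Definition num (x : loc) : A := (val (repr x)).1.
Definition den (x : loc) : A := (val (repr x)).2.

Lemma den_denom x : denom (den x).
Proof. exact: (valP (repr x)). Qed.

Lemma frac_eq a s b t : denom s -> denom t ->
  frac a s = frac b t <-> exists2 u, denom u & u * (a * t) = u * (b * s).
Proof.
move=> hs ht; rewrite /frac; split.
  move=> /eqmodP /asboolP /=.
  by rewrite !val_insubd /= hs ht.
move=> [u hu e]; apply/eqmodP/asboolP; exists u => //.
by rewrite !val_insubd /= hs ht.
Qed.

Lemma fracK x : frac (num x) (den x) = x.
Proof.
rewrite /frac -[RHS]reprK; congr (\pi_loc _); apply: val_inj.
rewrite val_insubd /= den_denom /num /den; exact: esym (surjective_pairing _).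
Qed.

Lemma fracP x : exists a s, denom s /\ x = frac a s.
Proof. by exists (num x), (den x); rewrite fracK den_denom. Qed.

Definition loc0 : loc := frac 0 1.
Definition loc1 : loc := frac 1 1.
Definition loc_opp (x : loc) : loc := frac (- num x) (den x).
Definition loc_add (x y : loc) : loc :=
  frac (num x * den y + num y * den x) (den x * den y).
Definition loc_mul (x y : loc) : loc := frac (num x * num y) (den x * den y).

Lemma loc_oppE a s : denom s -> loc_opp (frac a s) = frac (- a) s.
Proof.
move=> hs; have hd := den_denom (frac a s).
have /(frac_eq _ _ hd hs)[u hu e] := fracK (frac a s).
apply/frac_eq => //; exists u => //.
by rewrite !mulNr !mulrN e.
Qed.

Lemma loc_addE a s b t : denom s -> denom t ->
  loc_add (frac a s) (frac b t) = frac (a * t + b * s) (s * t).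
Proof.
move=> hs ht.
have hds := den_denom (frac a s); have hdt := den_denom (frac b t).
have /(frac_eq _ _ hds hs)[u hu e] := fracK (frac a s).
have /(frac_eq _ _ hdt ht)[v hv e'] := fracK (frac b t).
apply/frac_eq; rewrite ?denomM //; exists (u * v); first exact: denomM.
transitivity (u * (num (frac a s) * s) * (v * den (frac b t) * t)
  + v * (num (frac b t) * t) * (u * den (frac a s) * s)); first by ring.
by rewrite e e'; ring.
Qed.

Lemma loc_mulE a s b t : denom s -> denom t ->
  loc_mul (frac a s) (frac b t) = frac (a * b) (s * t).
Proof.
move=> hs ht.
have hds := den_denom (frac a s); have hdt := den_denom (frac b t).
have /(frac_eq _ _ hds hs)[u hu e] := fracK (frac a s).
have /(frac_eq _ _ hdt ht)[v hv e'] := fracK (frac b t).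
apply/frac_eq; rewrite ?denomM //; exists (u * v); first exact: denomM.
transitivity (u * (num (frac a s) * s) * (v * (num (frac b t) * t))).
  by ring.
by rewrite e e'; ring.
Qed.

Let denoms := (denomM, denom1).

Lemma loc_addA : associative loc_add.
Proof.
move=> x y z; have [a [s [hs ->]]] := fracP x; have [b [t [ht ->]]] := fracP y.
have [c [r [hr ->]]] := fracP z; rewrite !loc_addE ?denoms //.
by congr frac; ring.
Qed.

Lemma loc_addC : commutative loc_add.
Proof.
move=> x y; have [a [s [hs ->]]] := fracP x; have [b [t [ht ->]]] := fracP y.
by rewrite !loc_addE //; congr frac; ring.
Qed.

Lemma loc_add0 : left_id loc0 loc_add.
Proof.
move=> x; have [a [s [hs ->]]] := fracP x.
by rewrite loc_addE ?denoms //; congr frac; ring.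
Qed.

Lemma loc_addN : left_inverse loc0 loc_opp loc_add.
Proof.
move=> x; have [a [s [hs ->]]] := fracP x.
rewrite loc_oppE // loc_addE //; apply/frac_eq; rewrite ?denoms //.
by exists 1; rewrite ?denoms //; ring.
Qed.

Lemma loc_mulA : associative loc_mul.
Proof.
move=> x y z; have [a [s [hs ->]]] := fracP x; have [b [t [ht ->]]] := fracP y.
have [c [r [hr ->]]] := fracP z; rewrite !loc_mulE ?denoms //.
by congr frac; ring.
Qed.

Lemma loc_mulC : commutative loc_mul.
Proof.
move=> x y; have [a [s [hs ->]]] := fracP x; have [b [t [ht ->]]] := fracP y.
by rewrite !loc_mulE //; congr frac; ring.
Qed.

Lemma loc_mul1 : left_id loc1 loc_mul.
Proof.
move=> x; have [a [s [hs ->]]] := fracP x.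
by rewrite loc_mulE ?denoms //; congr frac; ring.
Qed.

Lemma loc_mulDl : left_distributive loc_mul loc_add.
Proof.
move=> x y z; have [a [s [hs ->]]] := fracP x; have [b [t [ht ->]]] := fracP y.
have [c [r [hr ->]]] := fracP z.
rewrite !(loc_addE, loc_mulE) ?denoms //; apply/frac_eq; rewrite ?denoms //.
by exists 1; rewrite ?denoms //; ring.
Qed.

HB.instance Definition _ := GRing.isZmodule.Build loc
  loc_addA loc_addC loc_add0 loc_addN.
HB.instance Definition _ := GRing.Zmodule_isComPzRing.Build loc
  loc_mulA loc_mulC loc_mul1 loc_mulDl.

Lemma fracD a s b t : denom s -> denom t ->
  frac a s + frac b t = frac (a * t + b * s) (s * t).
Proof. exact: loc_addE. Qed.

Lemma fracM a s b t : denom s -> denom t ->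
  frac a s * frac b t = frac (a * b) (s * t).
Proof. exact: loc_mulE. Qed.

Lemma fracN a s : denom s -> - frac a s = frac (- a) s.
Proof. exact: loc_oppE. Qed.

Lemma frac0 : frac 0 1 = 0. Proof. by []. Qed.
Lemma frac1 : frac 1 1 = 1. Proof. by []. Qed.

End Localization.

Definition spec_space (A : comPzRingType) : topologicalType :=
  [the topologicalType of prime_ideal A].

Section StructureSheaf.
Variable A : comPzRingType.
Notation X := (spec_space A).

(* The sections over U are the functions s on U with s(p) in A_p that are
   locally of the form p |-> a / f. *)
Definition locally_frac (U : opens X)
    (s : forall p : pts U, loc (sval p)) : Prop :=
  forall p : pts U, exists (V : opens X) (a f : A), oset V (sval p) /\
    forall q : pts U, oset V (sval q) -> denom (sval q) f /\ s q = frac (sval q) a f.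

Record spec_sec (U : opens X) := SpecSec {
  spec_val :> forall p : pts U, loc (sval p);
  spec_valP : locally_frac spec_val }.

Lemma spec_sec_ext U (s t : spec_sec U) : (forall p, s p = t p) -> s = t.
Proof.
case: s t => [s sP] [t tP] /= e.
have {}e : s = t by apply: functional_extensionality_dep.
by subst t; congr SpecSec; apply: Prop_irrelevance.
Qed.

Section Ring.
Variable U : opens X.

HB.instance Definition _ := gen_eqMixin (spec_sec U).
HB.instance Definition _ := gen_choiceMixin (spec_sec U).

Lemma locally_frac_const a : locally_frac (fun p : pts U => frac (sval p) a 1).
Proof. by move=> p; exists U, a, 1; split=> [|q _]; [exact: (svalP p)|rewrite denom1]. Qed.

(* The image of an element of A in the ring of sections over U. *)
Definition spec_const a : spec_sec U := SpecSec (@locally_frac_const a).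

Lemma locally_frac_opp (s : spec_sec U) :
  locally_frac (fun p => - s p).
Proof.
move=> p; have [V [a [f [Vp h]]]] := spec_valP s p.
exists V, (- a), f; split=> // q /h[hf ->]; split=> //.
exact: fracN.
Qed.

Lemma locally_frac_add (s t : spec_sec U) :
  locally_frac (fun p => s p + t p).
Proof.
move=> p; have [V [a [f [Vp h]]]] := spec_valP s p.
have [W [b [g [Wp k]]]] := spec_valP t p.
exists (openI_ V W), (a * g + b * f), (f * g); split=> // q [/h[hf ->] /k[hg ->]].
by split; [exact: denomM | exact: fracD].
Qed.

Lemma locally_frac_mul (s t : spec_sec U) :
  locally_frac (fun p => s p * t p).
Proof.
move=> p; have [V [a [f [Vp h]]]] := spec_valP s p.
have [W [b [g [Wp k]]]] := spec_valP t p.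
exists (openI_ V W), (a * b), (f * g); split=> // q [/h[hf ->] /k[hg ->]].
by split; [exact: denomM | exact: fracM].
Qed.

Definition spec_opp s : spec_sec U := SpecSec (@locally_frac_opp s).
Definition spec_add s t : spec_sec U := SpecSec (@locally_frac_add s t).
Definition spec_mul s t : spec_sec U := SpecSec (@locally_frac_mul s t).

Lemma spec_addA : associative spec_add.
Proof. by move=> s t u; apply: spec_sec_ext => p /=; rewrite addrA. Qed.
Lemma spec_addC : commutative spec_add.
Proof. by move=> s t; apply: spec_sec_ext => p /=; rewrite addrC. Qed.
Lemma spec_add0 : left_id (spec_const 0) spec_add.
Proof. by move=> s; apply: spec_sec_ext => p /=; rewrite frac0 add0r. Qed.
Lemma spec_addN : left_inverse (spec_const 0) spec_opp spec_add.
Proof. by move=> s; apply: spec_sec_ext => p /=; rewrite addNr. Qed.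
Lemma spec_mulA : associative spec_mul.
Proof. by move=> s t u; apply: spec_sec_ext => p /=; rewrite mulrA. Qed.
Lemma spec_mulC : commutative spec_mul.
Proof. by move=> s t; apply: spec_sec_ext => p /=; rewrite mulrC. Qed.
Lemma spec_mul1 : left_id (spec_const 1) spec_mul.
Proof. by move=> s; apply: spec_sec_ext => p /=; rewrite frac1 mul1r. Qed.
Lemma spec_mulDl : left_distributive spec_mul spec_add.
Proof. by move=> s t u; apply: spec_sec_ext => p /=; rewrite mulrDl. Qed.

HB.instance Definition _ := GRing.isZmodule.Build (spec_sec U)
  spec_addA spec_addC spec_add0 spec_addN.
HB.instance Definition _ := GRing.Zmodule_isComPzRing.Build (spec_sec U)
  spec_mulA spec_mulC spec_mul1 spec_mulDl.

End Ring.

Section Restriction.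
Variables (U V : opens X) (h : V `<=` U).

Definition incl (p : pts V) : pts U :=
  exist (oset U) (sval p) (h (proj2_sig p)).

Lemma locally_frac_res (s : spec_sec U) :
  locally_frac (fun p : pts V => s (incl p)).
Proof.
move=> p; have [W [a [f [Wp k]]]] := spec_valP s (incl p).
by exists W, a, f; split=> // q /(k (incl q)).
Qed.

Definition spec_res (s : spec_sec U) : spec_sec V :=
  SpecSec (@locally_frac_res s).

Lemma spec_res_zmod : zmod_morphism spec_res.
Proof. by move=> s t; apply: spec_sec_ext. Qed.
Lemma spec_res_monoid : monoid_morphism spec_res.
Proof. by split=> [|s t]; apply: spec_sec_ext. Qed.

HB.instance Definition _ :=
  GRing.isZmodMorphism.Build (spec_sec U) (spec_sec V) spec_res spec_res_zmod.
HB.instance Definition _ :=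
  GRing.isMonoidMorphism.Build (spec_sec U) (spec_sec V) spec_res
    spec_res_monoid.

End Restriction.

Lemma spec_val_irr (U : opens X) (s : spec_sec U) (p : X) (h h' : oset U p) :
  s (exist _ p h) = s (exist _ p h').
Proof. by rewrite (Prop_irrelevance h h'). Qed.

Lemma spec_res_id (U : opens X) (h : U `<=` U) s : spec_res h s = s.
Proof. by apply: spec_sec_ext => -[p Up]; exact: (spec_val_irr s (h p Up) Up). Qed.

Lemma spec_res_comp (U V W : opens X) (h1 : V `<=` U) (h2 : W `<=` V)
  (h3 : W `<=` U) s : spec_res h2 (spec_res h1 s) = spec_res h3 s.
Proof. by apply: spec_sec_ext => -[p Wp];
  exact: (spec_val_irr s (h1 p (h2 p Wp)) (h3 p Wp)). Qed.

Lemma spec_glue (U : opens X) (I : Type) (V : I -> opens X)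
    (VU : forall i, V i `<=` U) :
  U `<=` \bigcup_i V i ->
  forall s : forall i, spec_sec (V i),
  (forall i j (W : opens X) (hi : W `<=` V i) (hj : W `<=` V j),
     spec_res hi (s i) = spec_res hj (s j)) ->
  exists! t : spec_sec U, forall i, spec_res (VU i) t = s i.
Proof.
move=> UV s sP.
have cov (p : pts U) : {i | oset (V i) (sval p)}.
  by apply: cid; have [i _ Vi] := UV _ (svalP p); exists i.
pose t (p : pts U) := s (sval (cov p)) (exist _ (sval p) (proj2_sig (cov p))).
have tE i p (Up : oset U p) (Vp : oset (V i) p) :
    t (exist _ p Up) = s i (exist _ p Vp).
  rewrite /t /=; case: (cov _) => j /= Vj.
  pose W := openI_ (V i) (V j).
  have hi : W `<=` V i by move=> x [].
  have hj : W `<=` V j by move=> x [].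
  have Wp : oset W p by split.
  have := congr1 (fun u : spec_sec W => u (exist _ p Wp)) (sP i j W hi hj).
  rewrite /= => e; transitivity (s i (incl hi (exist _ p Wp))).
    by rewrite e; exact: (spec_val_irr (s j) Vj (hj p Wp)).
  exact: (spec_val_irr (s i) (hi p Wp) Vp).
have tP : locally_frac t.
  move=> [p Up]; have [i _ Vi] := UV _ Up.
  have [W [a [f [Wp k]]]] := spec_valP (s i) (exist _ p Vi).
  exists (openI_ W (V i)), a, f; split=> // -[q Uq] [/= Wq Vq].
  by rewrite (tE i _ _ Vq); apply: (k (exist _ q Vq)).
exists (SpecSec tP); split=> [i|t' t'P].
  by apply: spec_sec_ext => -[p Vp]; apply: tE.
apply: spec_sec_ext => -[p Up] /=; have [i _ Vi] := UV _ Up.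
rewrite (tE i _ _ Vi) -(t'P i) /=; exact: (spec_val_irr t' (VU i p Vi) Up).
Qed.

Definition Spec : ringed_space :=
  @RingedSpace X (fun U => spec_sec U)
    (fun U V h => spec_res h : {rmorphism spec_sec U -> spec_sec V})
    spec_res_id spec_res_comp spec_glue.

End StructureSheaf.

Section SpecLocal.
Variable A : comPzRingType.
Notation X := (spec_space A).

Lemma loc_unitP (p : prime_ideal A) (a s : A) : denom p s ->
  (exists t, frac p a s * t = 1) <-> denom p a.
Proof.
move=> hs; split=> [[t]|ha].
  have [b [r [hr ->]]] := fracP t; rewrite fracM // -frac1.
  move/(frac_eq _ _ (denomM hs hr) (denom1 p)) => [u hu e].
  apply/denomP => pa.
  have /denomP[] : denom p (u * (1 * (s * r))) by rewrite !denomM ?denom1.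
  rewrite -e; apply: pidealM; rewrite mulr1 mulrC; exact: pidealM.
exists (frac p s a); rewrite fracM // -frac1.
by apply/frac_eq; rewrite ?denomM ?denom1 //; exists 1; rewrite ?denom1 //; ring.
Qed.

Lemma basic_open_subproof (a : A) : open [set p : X | denom p a].
Proof.
apply/zariski_openE; exists [set a]; apply/seteqP; split=> p /=.
  by move=> /denomP pa h; apply: pa; apply: h.
by move=> h; apply/denomP => pa; apply: h => _ ->.
Qed.

Definition basic_open (a : A) : opens X := Opens _ (basic_open_subproof a).

Lemma spec_germ_unitP (U : opens X) (s : spec_sec U) (p : pts U) :
  germ_unit (X := Spec A) (sval p) (s : sec (r := Spec A) U) <->
  exists t, s p * t = 1.
Proof.
case: p => p Up; split.
  move=> [V [h [t [Vp e]]]]; exists (t (exist _ p Vp)).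
  have := congr1 (fun u : spec_sec V => u (exist _ p Vp)) e.
  by rewrite /= frac1 => <-; congr (_ * _); apply: (spec_val_irr s Up (h p Vp)).
have [W [a [f [Wp k]]]] := spec_valP s (exist _ p Up).
have [hf e] := k (exist _ p Up) Wp.
rewrite e => /(loc_unitP _ hf) ha.
pose V := openI_ (openI_ U W) (basic_open a).
have VU : V `<=` U by move=> q [[]].
have tP : locally_frac (fun q : pts V => frac (sval q) f a).
  by move=> [q [[Uq Wq] aq]]; exists V, f, a; split=> // -[r [[Ur Wr] ar]] _.
exists V, VU, (SpecSec tP); split; first by [].
apply: spec_sec_ext => -[q Vq] /=.
have [[Uq Wq] aq] := Vq.
have [hfq ->] := k (incl VU (exist _ q Vq)) Wq.
rewrite [LHS]fracM //; apply/frac_eq; rewrite ?denomM ?denom1 //.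
by exists 1; rewrite ?denom1 //; ring.
Qed.

Lemma Spec_locally_ringed : locally_ringed (Spec A).
Proof.
move=> p U Up; split.
  move=> e; have := congr1 (fun u : spec_sec U => u (exist _ p Up)) e.
  rewrite /= => /(frac_eq _ _ (denom1 p) (denom1 p))[u /denomP hu].
  by rewrite mul0r mulr0 !mulr1 => e'; apply: hu; rewrite e'; apply: pideal0.
move=> s t; rewrite !(spec_germ_unitP _ (exist _ p Up)) /=.
change ((s + t) : spec_sec U) with (spec_add s t) => /=.
have [a [f [hf ->]]] := fracP ((s : spec_sec U) (exist _ p Up)).
have [b [g [hg ->]]] := fracP ((t : spec_sec U) (exist _ p Up)).
rewrite fracD // !loc_unitP ?denomM //.
move=> /negP/asboolPn/contrapT pa /negP/asboolPn/contrapT pb.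
move=> /denomP; apply; apply: pidealD; rewrite mulrC; exact: pidealM.
Qed.

End SpecLocal.

Section SpecMap.
Variables (A B : comPzRingType) (phi : {rmorphism A -> B}).

Definition comap (q : prime_ideal B) : prime_ideal A.
Proof.
refine (@PrimeIdeal A (phi @^-1` pideal q) _ _ _ _ _) => /=.
- by rewrite rmorph0; apply: pideal0.
- by move=> a b ha hb; rewrite rmorphD; apply: pidealD.
- by move=> a b hb; rewrite rmorphM; apply: pidealM.
- by rewrite rmorph1; apply: pideal1.
- by move=> a b; rewrite rmorphM; apply: pideal_prime.
Defined.

Lemma comap_cont (V : set (spec_space A)) :
  open V -> open ((comap : spec_space B -> spec_space A) @^-1` V).
Proof.
move=> /zariski_openE[S ->]; apply/zariski_openE; exists (phi @` S).
apply/seteqP; split=> q /= h h'; apply: h => a; first by move=> Sa; apply: h'; exists a.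
by move=> [b Sb <-]; apply: h'.
Qed.

Lemma denom_comap (q : prime_ideal B) s : denom (comap q) s = denom q (phi s).
Proof. by []. Qed.

(* The homomorphism from the localization of A at the preimage of q to B_q. *)
Definition loc_map (q : prime_ideal B) (x : loc (comap q)) : loc q :=
  frac q (phi (num x)) (phi (den x)).

Lemma loc_mapE q a s : denom (comap q) s ->
  loc_map (frac (comap q) a s) = frac q (phi a) (phi s).
Proof.
move=> hs; have hd := den_denom (frac (comap q) a s).
have /(frac_eq _ _ hd hs)[u hu e] := fracK (frac (comap q) a s).
apply/frac_eq; rewrite -?denom_comap //.
by exists (phi u); rewrite -?denom_comap // -!rmorphM e.
Qed.

Lemma loc_mapB q x y : loc_map (q := q) (x - y) = loc_map x - loc_map y.
Proof.
have [a [s [hs ->]]] := fracP x; have [b [t [ht ->]]] := fracP y.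
rewrite fracN // fracD // !loc_mapE ?denomM // fracN -?denom_comap //.
rewrite fracD -?denom_comap // !rmorphM rmorphD !rmorphM rmorphN.
by rewrite mulNr.
Qed.

Lemma loc_mapM q x y : loc_map (q := q) (x * y) = loc_map x * loc_map y.
Proof.
have [a [s [hs ->]]] := fracP x; have [b [t [ht ->]]] := fracP y.
by rewrite fracM // !loc_mapE ?denomM // fracM -?denom_comap // !rmorphM.
Qed.

Lemma loc_map1 q : loc_map (q := q) 1 = 1.
Proof. by rewrite -frac1 loc_mapE ?denom1 // rmorph1. Qed.

Section Comorphism.
Variable V : opens (spec_space A).
Let V' := preim comap_cont V.

Lemma locally_frac_map (s : spec_sec V) :
  locally_frac (fun q : pts V' =>
    loc_map (s (exist _ (comap (sval q)) (proj2_sig q)))).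
Proof.
move=> q; have [W [a [f [Wp k]]]] := spec_valP s (exist _ (comap (sval q)) (proj2_sig q)).
exists (preim comap_cont W), (phi a), (phi f); split=> // r Wr.
have [hf e] := k (exist _ (comap (sval r)) (proj2_sig r)) Wr.
by split=> //; rewrite e; apply: loc_mapE.
Qed.

Definition spec_map (s : spec_sec V) : spec_sec V' :=
  SpecSec (@locally_frac_map s).

Lemma spec_map_zmod : zmod_morphism spec_map.
Proof. by move=> s t; apply: spec_sec_ext => q; apply: loc_mapB. Qed.
Lemma spec_map_monoid : monoid_morphism spec_map.
Proof.
split=> [|s t]; apply: spec_sec_ext => q; last exact: loc_mapM.
exact: loc_map1.
Qed.

HB.instance Definition _ :=
  GRing.isZmodMorphism.Build (spec_sec V) (spec_sec V') spec_map spec_map_zmod.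
HB.instance Definition _ :=
  GRing.isMonoidMorphism.Build (spec_sec V) (spec_sec V') spec_map
    spec_map_monoid.

End Comorphism.

Lemma spec_map_res (U V : opens (spec_space A)) (h : V `<=` U)
    (h' : preim comap_cont V `<=` preim comap_cont U) (s : spec_sec U) :
  spec_res h' (spec_map s) = spec_map (spec_res h s).
Proof.
apply: spec_sec_ext => -[q Vq] /=; congr loc_map.
exact: (spec_val_irr s (h' q Vq) (h _ Vq)).
Qed.

Lemma spec_map_local (q : Spec B) (V : opens (Spec A)) (s : spec_sec V) :
  oset V (comap q) ->
  germ_unit (X := Spec B) q (spec_map s : sec (r := Spec B) (preim comap_cont V)) ->
  germ_unit (X := Spec A) (comap q) (s : sec (r := Spec A) V).
Proof.
move=> Vq /(spec_germ_unitP (U := preim comap_cont V) _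
  (exist (oset (preim comap_cont V)) q Vq)) /= h.
apply/(spec_germ_unitP _ (exist (oset V) (comap q) Vq)).
move: h; have [a [f [hf ->]]] := fracP (s (exist _ (comap q) Vq)).
by rewrite loc_mapE // !loc_unitP.
Qed.

Definition Spec_mor : mor (Spec B) (Spec A) :=
  @Mor (Spec B) (Spec A) comap comap_cont
    (fun V => @spec_map V : {rmorphism spec_sec V -> spec_sec (preim comap_cont V)})
    spec_map_res spec_map_local.

End SpecMap.

(** * Schemes over a ring *)

Section Extensionality.

Lemma rmorphism_ext (R S : comPzRingType) (f g : {rmorphism R -> S}) :
  f =1 g -> f = g.
Proof.
case: f g => [f [[f1] [f2]]] [g [[g1] [g2]]] /= e.
have {}e : f = g by apply: functional_extensionality_dep.
subst g; rewrite (Prop_irrelevance g1 f1).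
by rewrite (Prop_irrelevance g2 f2).
Qed.

Lemma mor_ext (X Y : ringed_space) (f g : mor X Y) :
  (forall x, f x = g x) ->
  (forall (V : opens Y) (W : opens X) (hf : W `<=` preim (mor_cont f) V)
     (hg : W `<=` preim (mor_cont g) V) (s : sec V),
     res hf (mor_sec f V s) = res hg (mor_sec g V s)) ->
  f = g.
Proof.
case: f g => [f fc fs fr fl] [g gc gs gr gl] /=.
move=> e; have {}e : f = g by apply: functional_extensionality_dep.
subst g; have e : fc = gc by apply: Prop_irrelevance.
subst gc => h.
have e : fs = gs.
  apply: functional_extensionality_dep => V; apply: rmorphism_ext => s.
  have hV : preim fc V `<=` preim fc V by [].
  by have := h V _ hV hV s; rewrite !res_id.
by subst gs; congr Mor; apply: Prop_irrelevance.
Qed.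

Lemma compmA (X Y Z T : ringed_space) (h : mor Z T) (g : mor Y Z) (f : mor X Y) :
  compm h (compm g f) = compm (compm h g) f.
Proof.
apply: mor_ext => // V W hf hg s /=; congr (res _ _); exact: Prop_irrelevance.
Qed.

Lemma compm1 (X Y : ringed_space) (f : mor X Y) : compm f (idm X) = f.
Proof.
apply: mor_ext => // V W hf hg s /=; congr (res _ _); exact: Prop_irrelevance.
Qed.

End Extensionality.

(* A locally ringed space in which every point has an open neighbourhood
   isomorphic to the spectrum of a ring. *)
Record scheme := Scheme {
  sch_space :> ringed_space;
  sch_local : locally_ringed sch_space;
  sch_affine : forall x : sch_space,
    exists (A : comPzRingType) (j : mor (Spec A) sch_space),
      open_immersion j /\ range j x }.

Lemma Spec_affine (A : comPzRingType) (x : Spec A) :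
  exists (B : comPzRingType) (j : mor (Spec B) (Spec A)),
    open_immersion j /\ range j x.
Proof.
exists A, (idm (Spec A)); split; last by exists x.
split=> [x1 x2 //|U|V _]; last by exists id.
by rewrite /= image_id.
Qed.

Definition SpecS (A : comPzRingType) : scheme :=
  Scheme (@Spec_locally_ringed A) (@Spec_affine A).

Record kscheme (k : comPzRingType) := KScheme {
  ksch :> scheme;
  kstr : mor ksch (SpecS k) }.

Record khom (k : comPzRingType) (X Y : kscheme k) := KHom {
  khom_mor :> mor X Y;
  khom_over : compm (kstr Y) khom_mor = kstr X }.

Section KCategory.
Variable k : comPzRingType.

Definition kid (X : kscheme k) : khom X X := KHom (compm1 (kstr X)).

Lemma kcomp_subproof (X Y Z : kscheme k) (g : khom Y Z) (f : khom X Y) :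
  compm (kstr Z) (compm g f) = kstr X.
Proof. by rewrite compmA !khom_over. Qed.

Definition kcomp (X Y Z : kscheme k) (g : khom Y Z) (f : khom X Y) : khom X Z :=
  KHom (kcomp_subproof g f).

Definition is_iso (X Y : kscheme k) (f : khom X Y) : Prop :=
  exists g : khom Y X, kcomp g f = kid X /\ kcomp f g = kid Y.

(* The homomorphism k -> O_X(U) given by the structure morphism. *)
Definition scalar (X : kscheme k) (U : opens X) (c : k) : sec U :=
  res (V := U) (fun x _ => I : oset (preim (mor_cont (kstr X)) openT_) x)
    (mor_sec (kstr X) openT_ (spec_const openT_ c)).

(* The k-algebra O_X(U) is generated by finitely many elements. *)
Definition fin_gen_sec (X : kscheme k) (U : opens X) : Prop :=
  exists gens : seq (sec U), forall S : set (sec U),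
    (forall c, S (scalar U c)) -> (forall s, s \in gens -> S s) ->
    (forall s t, S s -> S t -> S (s + t)) ->
    (forall s t, S s -> S t -> S (s * t)) ->
    forall s, S s.

Definition affine_open (X : scheme) (U : opens X) : Prop :=
  exists (A : comPzRingType) (j : mor (Spec A) X),
    open_immersion j /\ range j = oset U.

Definition finite_type (X : kscheme k) : Prop :=
  exists (n : nat) (U : 'I_n -> opens X),
    (forall i, affine_open (X := X) (U i) /\ fin_gen_sec (U i)) /\
    (forall x : X, exists i, oset (U i) x).

(* Products in the category of k-schemes, that is, fibre products over
   Spec k. *)
Record kprod (X Y : kscheme k) := KProd {
  kprod_obj :> kscheme k;
  kpr1 : khom kprod_obj X;
  kpr2 : khom kprod_obj Y;
  kprod_univ : forall (T : kscheme k) (a : khom T X) (b : khom T Y),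
    exists! h : khom T kprod_obj, kcomp kpr1 h = a /\ kcomp kpr2 h = b }.

(* The morphism u x v between products. *)
Definition is_kprod_map (X X' Y Y' : kscheme k) (P : kprod X Y)
    (P' : kprod X' Y') (u : khom X X') (v : khom Y Y') (w : khom P P') : Prop :=
  kcomp (kpr1 P') w = kcomp u (kpr1 P) /\ kcomp (kpr2 P') w = kcomp v (kpr2 P).

End KCategory.

(** * Jet schemes and arc spaces *)

(* The ring k[t]/(t^(m+1)). *)
Notation trunc_poly k m := {poly %/ ('X^(m.+1) : {poly k})}.

Section TruncatedPolynomials.
Variable k : comNzRingType.

Definition trunc_const (m : nat) : {rmorphism k -> trunc_poly k m} :=
  qpolyC ('X^(m.+1) : {poly k}).

Definition trunc_map (m m' : nat) (p : trunc_poly k m) : trunc_poly k m' :=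
  in_qpoly ('X^(m'.+1)) (p : {poly k}).

Lemma in_qpoly_trunc (m m' : nat) (p : {poly k}) : (m' <= m)%N ->
  in_qpoly 'X^(m'.+1) (in_qpoly 'X^(m.+1) p : {poly k}) = in_qpoly 'X^(m'.+1) p.
Proof.
move=> le; apply: val_inj; rewrite /= !mk_monic_Xn /=.
rewrite -!Pdiv.RingMonic.take_poly_rmodp; apply/polyP => i.
rewrite !coef_take_poly; case: ifP => // lt_i.
by rewrite (leq_trans lt_i).
Qed.

Section TruncMap.
Variables (m m' : nat) (le : (m' <= m)%N).

Lemma trunc_map_zmod : zmod_morphism (@trunc_map m m').
Proof. by move=> p q; rewrite /trunc_map -linearB. Qed.

Lemma trunc_map_monoid : monoid_morphism (@trunc_map m m').
Proof.
split=> [|p q].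
  by rewrite /trunc_map -(in_qpoly1 ('X^(m.+1))) in_qpoly_trunc // in_qpoly1.
by rewrite /trunc_map [p * q]/(in_qpoly _ _) in_qpoly_trunc // in_qpolyM.
Qed.

(* Reduction modulo t^(m'+1), for m' <= m. *)
Definition trunc_rmor : {rmorphism trunc_poly k m -> trunc_poly k m'} :=
  HB.pack (@trunc_map m m')
    (GRing.isZmodMorphism.Build _ _ _ trunc_map_zmod)
    (GRing.isMonoidMorphism.Build _ _ _ trunc_map_monoid).

Lemma trunc_rmor_const c : trunc_rmor (trunc_const m c) = trunc_const m' c.
Proof.
apply: val_inj; rewrite /= mk_monic_Xn /=.
by rewrite Pdiv.CommonRing.rmodp_small // size_polyC size_polyXn; case: eqP.
Qed.

End TruncMap.
End TruncatedPolynomials.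

Lemma Spec_mor_comp (A B C : comPzRingType) (phi : {rmorphism A -> B})
    (psi : {rmorphism B -> C}) (chi : {rmorphism A -> C}) :
  (forall a, psi (phi a) = chi a) ->
  compm (Spec_mor phi) (Spec_mor psi) = Spec_mor chi.
Proof.
move=> e.
have E q : comap phi (comap psi q) = comap chi q.
  by apply: prime_ideal_ext; apply/seteqP; split=> a /=; rewrite e.
apply: mor_ext => // V W hf hg s; apply: spec_sec_ext => -[q Wq].
have [O [a [f [Oq k]]]] := spec_valP (s : spec_sec V) (exist (oset V) _ (hf q Wq)).
have [hf1 e1] := k (exist (oset V) _ (hf q Wq)) Oq.
have Oq2 : oset O (comap chi q) by rewrite -E.
have [hf2 e2] := k (exist (oset V) _ (hg q Wq)) Oq2.
transitivity (loc_map (loc_map (frac (comap phi (comap psi q)) a f))).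
  by rewrite -e1.
transitivity (loc_map (frac (comap chi q) a f)); last by rewrite -e2.
by rewrite !loc_mapE // !e.
Qed.

Section Jets.
Variable k : comNzRingType.

(* Spec k[t]/(t^(m+1)) as a k-scheme. *)
Definition jet_disc (m : nat) : kscheme k :=
  @KScheme k (SpecS (trunc_poly k m)) (Spec_mor (trunc_const k m)).

(* The closed immersion given by reduction modulo t^(m'+1). *)
Definition jet_disc_incl (m m' : nat) (le : (m' <= m)%N) :
    khom (jet_disc m') (jet_disc m) :=
  @KHom k (jet_disc m') (jet_disc m) (Spec_mor (trunc_rmor k le))
    (Spec_mor_comp (trunc_rmor_const (k := k) le)).

(* A k-scheme together with a natural bijection
     Hom_k(Z, X_m) = Hom_k(Z x Spec k[t]/(t^(m+1)), X).
   The bijection is given for every fibre product of Z with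
   Spec k[t]/(t^(m+1)); naturality for u = id says that it does not depend on
   the choice of the fibre product. *)
Record jet_scheme (m : nat) (X : kscheme k) := JetScheme {
  jet_obj :> kscheme k;
  jet_of : forall (Z : kscheme k) (P : kprod Z (jet_disc m)),
    khom Z jet_obj -> khom P X;
  jet_of_bij : forall Z P, bijective (@jet_of Z P);
  jet_of_nat : forall (Z Z' : kscheme k) (P : kprod Z (jet_disc m))
      (P' : kprod Z' (jet_disc m)) (u : khom Z' Z) (w : khom P' P),
    is_kprod_map u (kid (jet_disc m)) w ->
    forall h : khom Z jet_obj,
      jet_of P' (kcomp h u) = kcomp (jet_of P h) w }.

(* pi : X_m -> X_m' is the truncation morphism. *)
Definition is_truncation (X : kscheme k) (m m' : nat) (le : (m' <= m)%N)
    (J : jet_scheme m X) (J' : jet_scheme m' X) (pi : khom J J') : Prop :=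
  forall (Z : kscheme k) (P : kprod Z (jet_disc m))
    (P' : kprod Z (jet_disc m')) (w : khom P' P),
  is_kprod_map (kid Z) (jet_disc_incl le) w ->
  forall h : khom Z J, jet_of P' (kcomp pi h) = kcomp (jet_of P h) w.

(* fm : X_m -> Y_m is the morphism induced by f, composition of jets with f. *)
Definition is_jet_map (X Y : kscheme k) (f : khom X Y) (m : nat)
    (JX : jet_scheme m X) (JY : jet_scheme m Y) (fm : khom JX JY) : Prop :=
  forall (Z : kscheme k) (P : kprod Z (jet_disc m)) (h : khom Z JX),
    jet_of P (kcomp fm h) = kcomp f (jet_of P h).

(* The projective limit, in k-schemes, of the jet schemes of X along the
   truncation morphisms. *)
Record arc_space (X : kscheme k) := ArcSpace {
  arc_obj :> kscheme k;
  arc_jet : forall m, jet_scheme m X;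
  arc_trunc : forall m m', (m' < m)%N -> khom (arc_jet m) (arc_jet m');
  arc_truncP : forall m m' (lt : (m' < m)%N),
    is_truncation (ltnW lt) (arc_trunc lt);
  arc_proj : forall m, khom arc_obj (arc_jet m);
  arc_projP : forall m m' (lt : (m' < m)%N),
    kcomp (arc_trunc lt) (arc_proj m) = arc_proj m';
  arc_univ : forall (T : kscheme k) (c : forall m, khom T (arc_jet m)),
    (forall m m' (lt : (m' < m)%N), kcomp (arc_trunc lt) (c m) = c m') ->
    exists! h : khom T arc_obj, forall m, kcomp (arc_proj m) h = c m }.

(* g : X_oo -> Y_oo is the projective limit of the f_m. *)
Definition is_arc_map (X Y : kscheme k) (f : khom X Y)
    (AX : arc_space X) (AY : arc_space Y) (g : khom AX AY) : Prop :=
  exists fm : forall m, khom (arc_jet AX m) (arc_jet AY m),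
    (forall m, is_jet_map f (fm m)) /\
    (forall m, kcomp (arc_proj AY m) g = kcomp (fm m) (arc_proj AX m)).

(* Levels m in N u {oo}: [Some m] is the natural number m, [None] is oo. *)
Definition jet_space (m : option nat) (X : kscheme k) : Type :=
  match m with Some m => jet_scheme m X | None => arc_space X end.

Definition jet_space_obj (m : option nat) (X : kscheme k) :
    jet_space m X -> kscheme k :=
  match m with
  | Some m => fun J : jet_scheme m X => jet_obj J
  | None => fun A : arc_space X => arc_obj A
  end.

Definition is_induced (X Y : kscheme k) (f : khom X Y) (m : option nat) :
    forall (JX : jet_space m X) (JY : jet_space m Y),
      khom (jet_space_obj JX) (jet_space_obj JY) -> Prop :=
  match m with
  | Some m => fun JX JY fm => @is_jet_map X Y f m JX JY fm
  | None => fun AX AY g => @is_arc_map X Y f AX AY g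
  end.

End Jets.

(* Main.v *)
Require Import Defs.
From HB Require Import structures.
From mathcomp Require Import all_boot all_order all_algebra ring.
From mathcomp Require Import boolp classical_sets topology_structure.
(* Again, because [preim] is also a constant of [ssrbool]. *)
Import Defs.
Set Implicit Arguments.
Unset Strict Implicit.
Unset Printing Implicit Defensive.
Import GRing.Theory.
Local Open Scope ring_scope.
Local Open Scope classical_set_scope.

(* Let s_X : X -> X_m classify the jets that are constant in t, and let h be
   the composite of s_Y with the inverse of f_m.  As an element of
   X_m(Y) = Hom(Y x D_m, X), where D_m = Spec k[t]/(t^(m+1)), h restricts at
   t = 0 to a morphism g : Y -> X.  Since f_m h = s_Y, the composite f g is the
   restriction to t = 0 of a constant jet, so f g = id; since f_m s_X = s_Y f,
   also h f = s_X, whence g f = id.  For m = oo the same argument applies to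
   the jet of level 0 of h.

   The universal property of X_m(Z) says something only if the product
   Z x D_m exists.  It is built as the space of Z with the sheaf
   O_Z[t]/(t^(m+1)): morphisms T -> (Z, O_Z[t]/(t^(m+1))) are pairs of a
   morphism T -> Z and a global section of T whose (m+1)-st power is 0, and
   over an affine open Spec A of Z this ringed space is
   Spec A[t]/(t^(m+1)). *)

(** * Truncated polynomials *)

(** The ring A[t]/(t^(n+1)); the value at [i] is the coefficient of t^i. Coefficient vectors make
    sense over the zero ring too, which occurs as sections over the empty set. *)
Definition tpoly (n : nat) (A : comPzRingType) := {ffun 'I_n.+1 -> A}.

Section TruncatedRing.
Variables (n : nat) (A : comPzRingType).

HB.instance Definition _ := GRing.Zmodule.on (tpoly n A).

Definition tconst (a : A) : tpoly n A := [ffun i => a *+ (i == ord0)].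

Definition tmul (a b : tpoly n A) : tpoly n A :=
  [ffun i : 'I_n.+1 => \sum_j \sum_k a j * b k *+ (j + k == i)%N].

(** For [i] above [n] no index matches and the sum is 0. The vanishing hypothesis covers this case;
    it expresses the truncation. *)
Lemma sum_pick (B : nmodType) (F : nat -> B) (i : nat) :
  (forall j, (n < j)%N -> F j = 0) ->
  \sum_(x < n.+1) F x *+ (i == x)%N = F i.
Proof.
move=> F0; case: (ltnP i n.+1) => [lt_i|ge_i].
  rewrite (bigD1 (Ordinal lt_i)) //= eqxx big1 ?addr0 // => x ne.
  by rewrite eq_sym -(inj_eq val_inj) /= in ne *; rewrite (negbTE ne).
rewrite big1 ?F0 // => x _; case: eqP => // e.
by have := ltn_ord x; rewrite ltnNge -e ge_i.
Qed.

Lemma tmulC : commutative tmul.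
Proof.
move=> a b; apply/ffunP => i; rewrite !ffunE exchange_big /=.
by apply: eq_bigr => j _; apply: eq_bigr => k _; rewrite mulrC addnC.
Qed.

Lemma tmul1 : left_id (tconst 1) tmul.
Proof.
move=> a; apply/ffunP => i; rewrite ffunE (bigD1 ord0) //= [X in _ + X]big1.
  rewrite addr0 -[RHS](mulr1n); under eq_bigr => k _ do
    rewrite ffunE eqxx mul1r add0n.
  rewrite (bigD1 i) //= eqxx big1 ?addr0 // => k ne.
  by rewrite -(inj_eq val_inj) /= in ne; rewrite (negbTE ne).
move=> j ne; rewrite big1 // => k _.
by rewrite ffunE (negbTE ne) mul0r mul0rn.
Qed.

Lemma tmulDl : left_distributive tmul +%R.
Proof.
move=> a b c; apply/ffunP => i; rewrite !ffunE -big_split /=.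
apply: eq_bigr => j _; rewrite -big_split /=; apply: eq_bigr => k _.
by rewrite ffunE mulrDl mulrnDl.
Qed.

(** Summing out the degree [x] of the first product loses nothing, since a degree above [n] cannot
    contribute to coefficient [i]. The result treats the three factors alike, so associativity
    follows by commutativity. *)
Lemma tmulA3 (a b c : tpoly n A) (i : 'I_n.+1) : tmul (tmul a b) c i =
  \sum_j \sum_k \sum_l a j * b k * c l *+ (j + k + l == i)%N.
Proof.
rewrite ffunE.
transitivity (\sum_(x < n.+1) \sum_l \sum_j \sum_k
    (a j * b k * c l *+ (x + l == i)%N) *+ (j + k == x)%N).
  apply: eq_bigr => x _; apply: eq_bigr => l _.
  rewrite ffunE mulr_suml -sumrMnl; apply: eq_bigr => j _.
  rewrite mulr_suml -sumrMnl; apply: eq_bigr => k _.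
  by rewrite mulrnAl mulrnAC.
under eq_bigr => x _.
  rewrite exchange_big /=; under eq_bigr => j _ do rewrite exchange_big /=.
  over.
rewrite exchange_big /=; apply: eq_bigr => j _.
rewrite exchange_big /=; apply: eq_bigr => k _.
rewrite exchange_big /=; apply: eq_bigr => l _.
rewrite (sum_pick (F := fun x => a j * b k * c l *+ (x + l == i)%N)) // => x.
move=> lt_x; case: eqP => // e; have := leq_trans lt_x (leq_addr l x).
by rewrite e ltnNge -ltnS ltn_ord.
Qed.

Lemma tmulA : associative tmul.
Proof.
move=> a b c; rewrite [tmul a _]tmulC; apply/ffunP => i; rewrite !tmulA3.
under eq_bigr => j _ do rewrite exchange_big /=.
rewrite exchange_big /=; apply: eq_bigr => j _; apply: eq_bigr => k _.
apply: eq_bigr => l _.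
by rewrite [b k * _ * _]mulrC mulrA [(k + l + j)%N]addnC addnA.
Qed.

HB.instance Definition _ := GRing.Zmodule_isComPzRing.Build (tpoly n A)
  tmulA tmulC tmul1 tmulDl.

Lemma tmulE (a b : tpoly n A) i :
  (a * b) i = \sum_j \sum_k a j * b k *+ (j + k == i)%N.
Proof. by rewrite ffunE. Qed.

Lemma tconst_zmod : zmod_morphism tconst.
Proof. by move=> a b; apply/ffunP => i; rewrite !ffunE mulrnBl. Qed.

Lemma tconst_monoid : monoid_morphism tconst.
Proof.
split=> // a b; apply/ffunP => i; rewrite tmulE (bigD1 ord0) //=.
rewrite [X in _ + X]big1 ?addr0 => [|j ne]; last first.
  by rewrite big1 // => k _; rewrite !ffunE (negbTE ne) mul0r mul0rn.
rewrite (bigD1 ord0) //= big1 ?addr0 => [|j ne]; last first.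
  by rewrite !ffunE (negbTE ne) mulr0 mul0rn.
by rewrite !ffunE eqxx eq_sym.
Qed.

HB.instance Definition _ := GRing.isZmodMorphism.Build _ _ tconst tconst_zmod.
HB.instance Definition _ :=
  GRing.isMonoidMorphism.Build _ _ tconst tconst_monoid.

Definition tcoef0 (a : tpoly n A) : A := a ord0.

Lemma tcoef0_zmod : zmod_morphism tcoef0.
Proof. by move=> a b; rewrite /tcoef0 !ffunE. Qed.

Lemma tcoef0_monoid : monoid_morphism tcoef0.
Proof.
split=> [|a b]; first by rewrite /tcoef0 ffunE.
rewrite /tcoef0 tmulE (bigD1 ord0) //= [X in _ + X]big1 ?addr0 => [|j ne].
  rewrite (bigD1 ord0) //= big1 ?addr0 // => j ne.
  by rewrite -(inj_eq val_inj) /= in ne; rewrite add0n (negbTE ne).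
rewrite big1 // => k _; rewrite -(inj_eq val_inj) /= in ne.
by rewrite addn_eq0 (negbTE ne).
Qed.

HB.instance Definition _ := GRing.isZmodMorphism.Build _ _ tcoef0 tcoef0_zmod.
HB.instance Definition _ :=
  GRing.isMonoidMorphism.Build _ _ tcoef0 tcoef0_monoid.

Lemma tcoef0_const a : tcoef0 (tconst a) = a.
Proof. by rewrite /tcoef0 ffunE. Qed.

Definition tvar : tpoly n A := [ffun i : 'I_n.+1 => (i == 1 :> nat)%N%:R].

Lemma tvarX j : tvar ^+ j = [ffun i : 'I_n.+1 => (i == j :> nat)%:R].
Proof.
elim: j => [|j IH]; first by apply/ffunP => i; rewrite !ffunE.
rewrite exprS IH; apply/ffunP => i; rewrite tmulE exchange_big /= ffunE.
transitivity (\sum_(k < n.+1) (1 + k == i)%N%:R *+ (j == k)%N : A).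
  apply: eq_bigr => k _.
  rewrite -(sum_pick (F := fun x => (x + k == i)%N%:R *+ (j == k)%N)).
    apply: eq_bigr => l _; rewrite !ffunE eq_sym [(k == _ :> nat)%N]eq_sym.
    by case: eqP; case: eqP; case: eqP;
      rewrite /= ?mulr1 ?mulr0 ?mul0rn ?mul1r.
  move=> x lt_x; case: eqP => [e|_]; last by rewrite mul0rn.
  have := leq_trans lt_x (leq_addr k x).
  by rewrite e ltnNge -ltnS ltn_ord.
rewrite (sum_pick (F := fun x => (1 + x == i)%N%:R)) ?add1n 1?eq_sym // => x.
move=> lt_x; case: eqP => // e; have := ltn_ord i.
by rewrite -e ltnS add1n => /ltnW; rewrite leqNgt lt_x.
Qed.

Lemma tvar_nilp : tvar ^+ n.+1 = 0.
Proof.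
rewrite tvarX; apply/ffunP => i; rewrite !ffunE.
by case: eqP (ltn_ord i) => // ->; rewrite ltnn.
Qed.

(** Without a constant term, the power [a ^+ m] has no terms of degree below [m]. *)
Lemma tcoef0_nilp (a : tpoly n A) : tcoef0 a = 0 -> a ^+ n.+1 = 0.
Proof.
move=> a0.
have low m (i : 'I_n.+1) : (i < m)%N -> (a ^+ m) i = 0.
  elim: m i => // m IH i lt_i; rewrite exprS tmulE big1 // => j _.
  rewrite big1 // => k _; case: eqP => [e|]; last by rewrite mulr0n.
  have [->|j0] := eqVneq j ord0; first by rewrite [a _]a0 mul0r.
  rewrite IH ?mulr0 //; apply: leq_trans (_ : k < i)%N lt_i.
  by rewrite -e -add1n leq_add2r lt0n.
by apply/ffunP => i; rewrite low // ffunE.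
Qed.

End TruncatedRing.

(** The sum x + y = x - (-y) divides x^m - (-y)^m = x^m, which is a unit with inverse r^m. *)
Lemma unit_nilp (R : comPzRingType) (x y r : R) (m : nat) :
  x * r = 1 -> y ^+ m = 0 -> exists z, (x + y) * z = 1.
Proof.
move=> xr ym.
exists ((\sum_(i < m) x ^+ (m.-1 - i) * (- y) ^+ i) * r ^+ m).
rewrite mulrA -{1}[y]opprK -subrXX exprNn ym mulr0 subr0.
by rewrite -exprMn xr expr1n.
Qed.

Section Evaluation.
Variables (n : nat) (A B : comPzRingType) (phi : {rmorphism A -> B}) (tau : B).

(** The extension of [phi] that sends t to [tau]. It is additive for every [tau]; multiplicativity
    uses that [tau ^+ n.+1] is 0. *)
Definition ev (a : tpoly n A) : B := \sum_i phi (a i) * tau ^+ i.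

Lemma ev_zmod : zmod_morphism ev.
Proof.
move=> a b; rewrite /ev -sumrB; apply: eq_bigr => i _.
by rewrite !ffunE rmorphB mulrBl.
Qed.

HB.instance Definition _ := GRing.isZmodMorphism.Build _ _ ev ev_zmod.

Lemma ev_const a : ev (tconst n a) = phi a.
Proof.
rewrite /ev (bigD1 ord0) //= big1 ?addr0 => [|i ne].
  by rewrite ffunE eqxx mulr1.
by rewrite ffunE (negbTE ne) rmorph0 mul0r.
Qed.

Hypothesis tau_nilp : tau ^+ n.+1 = 0.

Lemma tau_big j : (n < j)%N -> tau ^+ j = 0.
Proof. by move=> lt; rewrite -(subnK lt) exprD tau_nilp mulr0. Qed.

Lemma ev_monoid : monoid_morphism ev.
Proof.
split=> [|a b]; first by rewrite ev_const rmorph1.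
rewrite /ev mulr_suml; under [RHS]eq_bigr => j _ do rewrite mulr_sumr.
transitivity (\sum_(i < n.+1) \sum_j \sum_k
    (phi (a j) * phi (b k) * tau ^+ i) *+ (j + k == i)%N).
  apply: eq_bigr => i _; rewrite tmulE rmorph_sum mulr_suml.
  apply: eq_bigr => j _; rewrite rmorph_sum mulr_suml; apply: eq_bigr => k _.
  by rewrite rmorphMn rmorphM mulrnAl.
rewrite exchange_big /=; apply: eq_bigr => j _.
rewrite exchange_big /=; apply: eq_bigr => k _.
rewrite (sum_pick (F := fun i => phi (a j) * phi (b k) * tau ^+ i)).
  by rewrite exprD mulrACA.
by move=> i lt; rewrite tau_big ?mulr0.
Qed.

Definition ev_rmor : {rmorphism tpoly n A -> B} :=
  HB.pack ev (GRing.isZmodMorphism.Build _ _ _ ev_zmod)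
    (GRing.isMonoidMorphism.Build _ _ _ ev_monoid).

Lemma ev_var : ev (tvar n A) = tau.
Proof.
rewrite /ev; under eq_bigr => i _ do
  rewrite ffunE rmorph_nat mulr_natl eq_sym.
by rewrite (sum_pick (F := fun i => tau ^+ i)) ?expr1 // => j /tau_big.
Qed.

End Evaluation.

Lemma tconst_mulE (n : nat) (A : comPzRingType) (c : A) (b : tpoly n A) i :
  (tconst n c * b) i = c * b i.
Proof.
rewrite tmulE (bigD1 ord0) //= [X in _ + X]big1 ?addr0 => [|j ne]; last first.
  by rewrite big1 // => k _; rewrite ffunE (negbTE ne) mul0r mul0rn.
rewrite (bigD1 i) //= big1 ?addr0 => [|j ne].
  by rewrite ffunE eqxx add0n eqxx.
by rewrite -(inj_eq val_inj) /= in ne; rewrite add0n (negbTE ne).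
Qed.

(** Every element is a polynomial in t with constant coefficients, so a homomorphism is determined
    by its values on constants and on t. *)
Lemma ev_id (n : nat) (A : comPzRingType) (a : tpoly n A) :
  ev (@tconst n A : {rmorphism A -> tpoly n A}) (tvar n A) a = a.
Proof.
apply/ffunP => i; rewrite /ev sum_ffunE (bigD1 i) //= big1 ?addr0 => [|j ne].
  by rewrite tconst_mulE tvarX ffunE eqxx mulr1.
rewrite tconst_mulE tvarX ffunE (inj_eq val_inj) eq_sym (negbTE ne).
by rewrite mulr0.
Qed.

Section Map.
Variables (n : nat) (A B : comPzRingType) (phi : {rmorphism A -> B}).

Definition tmap (a : tpoly n A) : tpoly n B := [ffun i => phi (a i)].

Lemma tmap_zmod : zmod_morphism tmap.
Proof. by move=> a b; apply/ffunP => i; rewrite !ffunE rmorphB. Qed.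

Lemma tmap_monoid : monoid_morphism tmap.
Proof.
split=> [|a b]; first by apply/ffunP => i; rewrite !ffunE rmorphMn rmorph1.
apply/ffunP => i; rewrite ffunE !tmulE rmorph_sum; apply: eq_bigr => j _.
by rewrite rmorph_sum; apply: eq_bigr => k _; rewrite !ffunE rmorphMn rmorphM.
Qed.

HB.instance Definition _ := GRing.isZmodMorphism.Build _ _ tmap tmap_zmod.
HB.instance Definition _ := GRing.isMonoidMorphism.Build _ _ tmap tmap_monoid.

Lemma tmap_const a : tmap (tconst n a) = tconst n (phi a).
Proof. by apply/ffunP => i; rewrite !ffunE rmorphMn. Qed.

Lemma tmap_var : tmap (tvar n A) = tvar n B.
Proof. by apply/ffunP => i; rewrite !ffunE rmorph_nat. Qed.

End Map.

Lemma tmap_bij (n : nat) (A B : comPzRingType) (phi : {rmorphism A -> B}) :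
  bijective phi -> bijective (tmap (n := n) phi).
Proof.
move=> [g gK Kg]; exists (fun b : tpoly n B => [ffun i => g (b i)]) => b;
  by apply/ffunP => i; rewrite !ffunE.
Qed.

(** * Thickened spaces *)

Section ThickSpace.
Variables (n : nat) (X : ringed_space).

Definition thick_res (U V : opens X) (h : V `<=` U) :
    {rmorphism tpoly n (sec U) -> tpoly n (sec V)} := tmap (res h).

Lemma thick_res_id (U : opens X) (h : U `<=` U) s : thick_res h s = s.
Proof. by apply/ffunP => i; rewrite ffunE res_id. Qed.

Lemma thick_res_comp (U V W : opens X) (h1 : V `<=` U) (h2 : W `<=` V)
    (h3 : W `<=` U) s :
  thick_res h2 (thick_res h1 s) = thick_res h3 s.
Proof. by apply/ffunP => i; rewrite !ffunE (res_comp _ _ h3). Qed.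

(** As a sheaf of sets this is a finite power of the structure sheaf, so gluing is done coefficient
    by coefficient. *)
Lemma thick_res_glue (U : opens X) (I : Type) (V : I -> opens X)
    (VU : forall i, V i `<=` U) :
  U `<=` \bigcup_i V i ->
  forall s : forall i, tpoly n (sec (V i)),
  (forall i j (W : opens X) (hi : W `<=` V i) (hj : W `<=` V j),
     thick_res hi (s i) = thick_res hj (s j)) ->
  exists! t : tpoly n (sec U), forall i, thick_res (VU i) t = s i.
Proof.
move=> UV s sP.
have glue l : exists! t : sec U, forall i, res (VU i) t = s i l.
  apply: (res_glue VU UV) => i j W hi hj.
  by have /ffunP/(_ l) := sP i j W hi hj; rewrite !ffunE.
have /fin_all_exists [t tP] l := glue l.
exists (finfun t); split=> [i|t' t'P].
  by apply/ffunP => l; rewrite !ffunE; apply: (tP l).1.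
apply/ffunP => l; rewrite ffunE; apply: (tP l).2 => i.
by rewrite -t'P ffunE.
Qed.

(* The fibre product of X with Spec Z[t]/(t^(n+1)): it has the underlying
   space of X because t is nilpotent. *)
Definition thick : ringed_space :=
  @RingedSpace X (fun U => tpoly n (sec U)) thick_res thick_res_id
    thick_res_comp thick_res_glue.

(** One direction sets t = 0. For the other, a section is its constant term plus a nilpotent, and
    [unit_nilp] applies. *)
Lemma germ_unit_thick (x : X) (U : opens X) (s : tpoly n (sec U)) :
  germ_unit (X := thick) x (s : sec (r := thick) U) <->
  germ_unit x (tcoef0 s).
Proof.
split=> [[V [h [t [Vx e]]]]|[V [h [t [Vx e]]]]].
  exists V, h, (tcoef0 t); split=> //.
  have := congr1 (@tcoef0 n _) e.
  by rewrite rmorphM rmorph1 /= {1}/tcoef0 ffunE.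
exists V, h; pose s' := tmap (res h) s.
have [z zP] : exists z,
    (tconst n (tcoef0 s') + (s' - tconst n (tcoef0 s'))) * z = 1.
  apply: (unit_nilp (r := tconst n t)); last first.
    by apply: tcoef0_nilp; rewrite rmorphB /= tcoef0_const subrr.
  by rewrite -rmorphM /= {1}/tcoef0 ffunE e rmorph1.
by exists z; split=> //; rewrite -zP addrC subrK.
Qed.

Lemma thick_locally_ringed : locally_ringed X -> locally_ringed thick.
Proof.
move=> loc x U Ux; have [ne0 addP] := loc x U Ux; split=> [e|s t].
  by apply: ne0; have := congr1 (@tcoef0 n _) e; rewrite rmorph1 rmorph0.
by rewrite !germ_unit_thick rmorphD; apply: addP.
Qed.

Definition thick_proj : mor thick X.
Proof.
refine (@Mor thick X (fun x => x) (fun V oV => oV)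
  (fun V => @tconst n (sec V)) _ _).
- move=> U V h h' s; rewrite /= tmap_const; congr (tconst _ (res _ _)).
  exact: Prop_irrelevance.
- move=> x V s Vx /(@germ_unit_thick x V _) /=.
  by rewrite tcoef0_const.
Defined.

End ThickSpace.

(** * Pullback of global sections and morphisms into thickened spaces *)

Definition subT (X : ringed_space) (U : opens X) : U `<=` openT_ :=
  fun x _ => I.

Lemma res_irr (X : ringed_space) (U V : opens X) (h h' : V `<=` U) s :
  res h s = res h' s.
Proof. by congr (res _ _); apply: Prop_irrelevance. Qed.

(** The images under [f] and [g] have different types; restricting both to a common [W] replaces a
    transport along [f = g]. *)
Lemma mor_sec_eq (X Y : ringed_space) (f g : mor X Y) (V : opens Y)
    (W : opens X) (hf : W `<=` preim (mor_cont f) V)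
    (hg : W `<=` preim (mor_cont g) V) s :
  f = g -> res hf (mor_sec f V s) = res hg (mor_sec g V s).
Proof. by move=> e; subst g; apply: res_irr. Qed.

Definition pullback (X Y : ringed_space) (f : mor X Y)
    (s : sec (openT_ : opens Y)) : sec (openT_ : opens X) :=
  res (V := openT_) (U := preim (mor_cont f) openT_) (fun x _ => I)
    (mor_sec f openT_ s).

Lemma pullback_res (X Y : ringed_space) (f : mor X Y) s (V : opens Y)
    (W : opens X) (h : W `<=` preim (mor_cont f) V) :
  res h (mor_sec f V (res (@subT Y V) s)) = res (@subT X W) (pullback f s).
Proof.
have h1 : preim (mor_cont f) V `<=` preim (mor_cont f) openT_ by [].
have h2 : W `<=` preim (mor_cont f) openT_ by [].
by rewrite -(mor_res (@subT Y V) h1) (res_comp _ _ h2) (res_comp _ _ h2).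
Qed.

Lemma pullback_comp (X Y Z : ringed_space) (g : mor Y Z) (f : mor X Y) s :
  pullback (compm g f) s = pullback f (pullback g s).
Proof.
have h : (openT_ : opens X) `<=`
  preim (mor_cont f) (preim (mor_cont g) openT_) by [].
have h' : preim (mor_cont f) openT_ `<=`
  preim (mor_cont f) (preim (mor_cont g) openT_) by [].
rewrite {2 3}/pullback -(mor_res _ h') (res_comp _ _ h).
exact: res_irr.
Qed.

Section HomThick.
Variables (n : nat) (T X : ringed_space) (a : mor T X).
Variable tau : sec (openT_ : opens T).
Hypothesis tau_nilp : tau ^+ n.+1 = 0.

Lemma res_nilp (W : opens T) : res (@subT T W) tau ^+ n.+1 = 0.
Proof. by rewrite -rmorphXn tau_nilp rmorph0. Qed.

Definition hom_thick_sec (V : opens X) :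
    {rmorphism tpoly n (sec V) -> sec (preim (mor_cont a) V)} :=
  ev_rmor (mor_sec a V) (res_nilp (preim (mor_cont a) V)).

(** The image of [s] differs by the nilpotent image of [d] from the image of its constant term, so
    the latter also has a unit germ, and [a] is local. *)
Lemma hom_thick_local (x : T) (V : opens X) (s : tpoly n (sec V)) :
  oset V (a x) -> germ_unit x (hom_thick_sec V s) ->
  germ_unit (X := thick n X) (a x) (s : sec (r := thick n X) V).
Proof.
move=> Vx [W [h [t [Wx e]]]]; apply/germ_unit_thick.
apply: (mor_local (m := a)) => //; exists W, h.
pose d := tconst n (tcoef0 s) - s.
have d_nilp : res h (hom_thick_sec V d) ^+ n.+1 = 0.
  rewrite -!rmorphXn tcoef0_nilp ?rmorph0 //.
  by rewrite rmorphB /= tcoef0_const subrr.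
have [z zP] := unit_nilp e d_nilp.
exists z; split=> //; rewrite -zP -2!rmorphD addrC subrK.
by congr (res _ _ * _); rewrite /= ev_const.
Qed.

Lemma hom_thick_res (U V : opens X) (h : V `<=` U)
    (h' : preim (mor_cont a) V `<=` preim (mor_cont a) U)
    (s : tpoly n (sec U)) :
  res h' (hom_thick_sec U s) = hom_thick_sec V (tmap (res h) s).
Proof.
rewrite /= /ev rmorph_sum; apply: eq_bigr => i _.
by rewrite rmorphM rmorphXn ffunE (res_comp _ _ (@subT _ _)) (mor_res h).
Qed.

(** Existence half of the universal property of [thick]; the uniqueness half is [thick_hom_ext]. *)
Definition hom_thick : mor T (thick n X) :=
  @Mor T (thick n X) a (mor_cont a) hom_thick_sec hom_thick_res hom_thick_local.

Lemma hom_thick_proj : compm (thick_proj n X) hom_thick = a.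
Proof.
apply: mor_ext => // V W hf hg s; rewrite /= ev_const; exact: res_irr.
Qed.

Lemma pullback_hom_thick : pullback hom_thick (tvar n _) = tau.
Proof.
rewrite /pullback /= ev_var; last exact: res_nilp.
by rewrite (res_comp _ _ (@subT _ _)) res_id.
Qed.

End HomThick.

(** By [ev_id], sections of the thickening are polynomials in t over sections of [X]; the first
    equation fixes the coefficients, the second fixes t. *)
Lemma thick_hom_ext n (T X : ringed_space) (g h : mor T (thick n X)) :
  compm (thick_proj n X) g = compm (thick_proj n X) h ->
  pullback g (tvar n _) = pullback h (tvar n _) -> g = h.
Proof.
move=> e et; apply: mor_ext => [x|V W hg hh s].
  exact: (congr1 (fun f : mor T X => f x) e).
rewrite -[s]ev_id /ev !rmorph_sum; apply: eq_bigr => i _.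
rewrite !rmorphM !rmorphXn; congr (_ * _ ^+ _).
  exact: (@mor_sec_eq _ _ (compm (thick_proj n X) g)
    (compm (thick_proj n X) h) V W hg hh (s i) e).
rewrite -(tmap_var n (res (@subT X V))).
have := pullback_res (f := g) (tvar n _) hg; rewrite /= => ->.
by have := pullback_res (f := h) (tvar n _) hh; rewrite /= => ->; rewrite et.
Qed.

(** * Thickened affine schemes *)

Section Fractions.
Variables (A : comPzRingType) (p : prime_ideal A).

Lemma pidealX a m : pideal p (a ^+ m) -> pideal p a.
Proof.
elim: m => [|m IH]; first by rewrite expr0 => /pideal1.
by rewrite exprS => /pideal_prime[].
Qed.

Lemma denomX s m : denom p s -> denom p (s ^+ m).
Proof. by move=> /denomP ps; apply/denomP => /pidealX. Qed.

Definition frac_of (a : A) : loc p := frac p a 1.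

Lemma frac_of_zmod : zmod_morphism frac_of.
Proof.
move=> a b; rewrite /frac_of fracN ?denom1 // fracD ?denom1 //.
by rewrite !mulr1.
Qed.

Lemma frac_of_monoid : monoid_morphism frac_of.
Proof. by split=> // a b; rewrite /frac_of fracM ?denom1 // mulr1. Qed.

HB.instance Definition _ :=
  GRing.isZmodMorphism.Build _ _ frac_of frac_of_zmod.
HB.instance Definition _ :=
  GRing.isMonoidMorphism.Build _ _ frac_of frac_of_monoid.

Lemma fracE a s : denom p s -> frac p a s = frac_of a * frac p 1 s.
Proof. by move=> ps; rewrite fracM ?denom1 // mulr1 mul1r. Qed.

Lemma common_denom n (x : 'I_n -> loc p) : exists (a : {ffun 'I_n -> A}) s,
  denom p s /\ forall i, x i = frac p (a i) s.
Proof.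
exists [ffun i => num (x i) * \prod_(j | j != i) den (x j)],
  (\prod_i den (x i)).
have den_prod (P : pred 'I_n) : denom p (\prod_(j | P j) den (x j)).
  apply: (big_ind (fun s => denom p s)) => [|s t|j _].
  - exact: denom1.
  - exact: denomM.
  exact: den_denom.
split=> // i; rewrite -[LHS]fracK; apply/frac_eq; rewrite ?den_denom //.
exists 1; first exact: denom1.
by rewrite ffunE [\prod_i0 _](bigD1 i) //=; ring.
Qed.

End Fractions.

(** Named so that it can carry a ring morphism structure and commute with sums and powers. *)
Definition spec_at (A : comPzRingType) (U : opens (spec_space A)) (p : pts U)
  (s : spec_sec U) : loc (sval p) := s p.

Section SpecAt.
Variables (A : comPzRingType) (U : opens (spec_space A)) (p : pts U).

Lemma spec_at_zmod : zmod_morphism (@spec_at A U p).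
Proof. by []. Qed.
Lemma spec_at_monoid : monoid_morphism (@spec_at A U p).
Proof. by []. Qed.

HB.instance Definition _ :=
  GRing.isZmodMorphism.Build _ _ (@spec_at A U p) spec_at_zmod.
HB.instance Definition _ :=
  GRing.isMonoidMorphism.Build _ _ (@spec_at A U p) spec_at_monoid.
End SpecAt.

(** With c the constant term, a = c - (c - a) divides c^(n+1) - (c - a)^(n+1), and the last power
    vanishes. Denominators in A[t]/(t^(n+1)) can thus be replaced by denominators from [A]. *)
Lemma tpoly_adj n (A : comPzRingType) (a : tpoly n A) :
  exists b, a * b = tconst n (tcoef0 a ^+ n.+1).
Proof.
pose c := tconst n (tcoef0 a).
exists (\sum_(i < n.+1) c ^+ (n.+1.-1 - i) * (c - a) ^+ i).
have nilp : (c - a) ^+ n.+1 = 0.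
  by apply: tcoef0_nilp; rewrite rmorphB /= tcoef0_const subrr.
have {1}-> : a = c - (c - a) by rewrite opprB addrC subrK.
by rewrite -subrXX nilp subr0 -rmorphXn.
Qed.

(** * Spectra of rings B identified with A[t]/(t^(n+1)) by evaluation at [tau] *)

Section AffineThick.
Variables (n : nat) (A B : comPzRingType) (phi : {rmorphism A -> B}) (tau : B).
Hypothesis tau_nilp : tau ^+ n.+1 = 0.
Variable rho : {rmorphism B -> tpoly n A}.
Hypothesis rhoK : forall b, ev phi tau (rho b) = b.
Hypothesis evK : forall a, rho (ev phi tau a) = a.

Let evr := ev_rmor phi tau_nilp.

(** The difference of [b] and the image of its constant term is nilpotent, so it lies in every
    prime. *)
Lemma denom_rho (q : prime_ideal B) b :
  denom (comap phi q) (tcoef0 (rho b)) = denom q b.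
Proof.
pose c := tcoef0 (rho b).
have : pideal q (b - phi c).
  apply: (pidealX (m := n.+1)).
  rewrite -{1}[b]rhoK -(ev_const n phi tau) -(rmorphB evr) -(rmorphXn evr).
  rewrite tcoef0_nilp ?rmorph0; first exact: pideal0.
  by rewrite rmorphB /= tcoef0_const subrr.
move=> qd; rewrite denom_comap -/c; apply/denomP/denomP => nq qb; apply: nq.
  have -> : phi c = b + (- 1) * (b - phi c) by ring.
  by apply: pidealD => //; apply: pidealM.
have -> : b = phi c + (b - phi c) by ring.
exact: pidealD.
Qed.

Definition proj0 : {rmorphism B -> A} := @tcoef0 n A \o rho.

Lemma proj0_phi a : proj0 (phi a) = a.
Proof. by rewrite /= -(ev_const n phi tau) evK tcoef0_const. Qed.

Lemma comap_phiK (p : prime_ideal A) : comap phi (comap proj0 p) = p.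
Proof.
by apply: prime_ideal_ext; apply/seteqP; split=> a /=;
  have /= -> := proj0_phi a.
Qed.

(** Modulo nilpotents [phi] after [proj0] is the identity, which [denom_rho] expresses on primes.
    With [comap_phiK], this identifies the points of Spec B and Spec A. *)
Lemma comap_projK (q : prime_ideal B) : comap proj0 (comap phi q) = q.
Proof.
apply: prime_ideal_ext; apply/seteqP; split=> b /= qb; apply: contrapT => nq.
  have /denomP : denom (comap phi q) (tcoef0 (rho b)).
    by rewrite denom_rho; apply/denomP.
  by apply.
have : denom q b by rewrite -denom_rho; apply/denomP.
by move=> /denomP; apply.
Qed.

(* Written in terms of [p] rather than [comap phi q] so that no transport
   along [comap phi q = p] is needed. *)
Lemma frac_ev_inj (q : prime_ideal B) (p : prime_ideal A)
    (c c' : tpoly n A) (e e' : A) :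
  comap phi q = p -> denom p e -> denom p e' ->
  frac q (ev phi tau c) (phi e) = frac q (ev phi tau c') (phi e') ->
  forall i, frac p (c i) e = frac p (c' i) e'.
Proof.
move=> E he he'; subst p; move/frac_eq => [] // u qu.
rewrite -[u]rhoK -!(ev_const n phi tau) -2!(rmorphM evr) -2!(rmorphM evr).
move=> /(congr1 rho); rewrite !evK => E i.
(* Multiplication by [v] turns the annihilating factor [rho u] into a constant, after which the
   equation can be read coefficient by coefficient. *)
have [v vE] := tpoly_adj (rho u).
apply/frac_eq => //; exists (tcoef0 (rho u) ^+ n.+1).
  by apply: denomX; rewrite denom_rho.
have := congr1 (fun a : tpoly n A => (v * a) i) E.
rewrite /= !mulrA [v * _]mulrC vE -!mulrA !tconst_mulE.
by rewrite [c * _]mulrC [c' * _]mulrC !tconst_mulE [e * _]mulrC [e' * _]mulrC.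
Qed.

(** Expand b/g by the cofactor that makes the denominator a constant. Since [c] and [e] do not
    depend on [q], a local expression of a section is rewritten on a whole neighbourhood at once. *)
Lemma frac_ev_surj (b g : B) : exists (c : tpoly n A) (e : A),
  forall q, denom q g -> denom (comap phi q) e /\
    frac q (ev phi tau c) (phi e) = frac q b g.
Proof.
have [v vE] := tpoly_adj (rho g).
exists (rho b * v), (tcoef0 (rho g) ^+ n.+1) => q qg.
have he : denom (comap phi q) (tcoef0 (rho g) ^+ n.+1).
  by apply: denomX; rewrite denom_rho.
split=> //; apply/frac_eq => //; exists 1; first exact: denom1.
rewrite !mul1r -(ev_const n phi tau) -vE -[in LHS](rhoK g).
rewrite -[X in _ = X * _]rhoK.
by rewrite -!(rmorphM evr); congr (evr _); ring.
Qed.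

Lemma const_nilp : (spec_const openT_ tau) ^+ n.+1 = 0.
Proof.
apply: spec_sec_ext => p.
rewrite -[LHS]/(spec_at p (spec_const openT_ tau ^+ n.+1)) rmorphXn.
by rewrite /spec_at /= -[frac _ _ _]/(frac_of _ _) -rmorphXn tau_nilp.
Qed.

Definition affine_thick : mor (Spec B) (thick n (Spec A)) :=
  hom_thick (T := Spec B) (X := Spec A) (Spec_mor phi) const_nilp.

Section Sections.
Variable U : opens (spec_space A).
Let U' : opens (spec_space B) := preim (comap_cont phi) U.

Definition affine_sec : {rmorphism tpoly n (spec_sec U) -> spec_sec U'} :=
  hom_thick_sec (T := Spec B) (X := Spec A) (Spec_mor phi) const_nilp U.

Lemma affine_sec_val (s : tpoly n (spec_sec U)) (q : pts U')
    (c : tpoly n A) (e : A) :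
  denom (comap phi (sval q)) e ->
  (forall i,
    s i (exist _ (comap phi (sval q)) (proj2_sig q)) = frac _ (c i) e) ->
  affine_sec s q = frac _ (ev phi tau c) (phi e).
Proof.
move=> he sE; rewrite -[LHS]/(spec_at q (affine_sec s)) /= /ev rmorph_sum.
rewrite fracE -?denom_comap // rmorph_sum mulr_suml; apply: eq_bigr => i _.
rewrite [in RHS]rmorphM [in RHS]rmorphXn [RHS]mulrAC.
transitivity (spec_at q (spec_map phi (s i)) *
    spec_at q (spec_res (@subT (Spec B) U') (spec_const openT_ tau)) ^+ i).
  by rewrite [LHS]rmorphM; congr (_ * _); exact: rmorphXn.
by congr (_ * _); rewrite /spec_at /= sE loc_mapE // fracE -?denom_comap.
Qed.

Lemma affine_sec_inj : injective affine_sec.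
Proof.
move=> s s' E; apply/ffunP => i; apply: spec_sec_ext => -[p Up].
have [q qE] : exists q, comap phi q = p.
  by exists (comap proj0 p); exact: comap_phiK.
subst p; pose q' : pts U := exist _ (comap phi q) Up.
have [c [e [he sE]]] := common_denom (fun i => s i q').
have [c' [e' [he' sE']]] := common_denom (fun i => s' i q').
rewrite sE sE'; apply: (frac_ev_inj (q := q)) => //.
pose r : pts U' := exist _ q Up.
rewrite -(affine_sec_val (q := r) he sE) -(affine_sec_val (q := r) he' sE').
by rewrite E.
Qed.

(** At each [p] in [U], write the value of [s] at the corresponding prime of [B] as [ev phi tau c]
    over [phi e]; the fractions of the coefficients of [c] by [e] form the preimage. The pairs are
    chosen pointwise, but near a given point a single pair works, and by [frac_ev_inj] it yields the
    same fractions. *)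
Lemma affine_sec_surj (s : spec_sec U') : exists t, affine_sec t = s.
Proof.
have loc_sol (p : pts U) : exists c_e : tpoly n A * A,
    denom (sval p) c_e.2 /\ forall q : pts U', comap phi (sval q) = sval p ->
      s q = frac _ (ev phi tau c_e.1) (phi c_e.2).
  case: p => p Up; have Uq : oset U' (comap proj0 p) by rewrite /= comap_phiK.
  have [b [g [hg sE]]] := fracP (s (exist _ _ Uq)).
  have [c [e ce]] := frac_ev_surj b g; exists (c, e).
  have [he ceE] := ce _ hg; split; first by move: he; rewrite comap_phiK.
  move=> -[q Uq'] /= E; have {}E : q = comap proj0 p by rewrite -E comap_projK.
  by subst q; rewrite ceE -sE; apply: spec_val_irr.
have {loc_sol} [ce ceP] := choice loc_sol.
have tP i : locally_frac (fun p : pts U => frac (sval p) ((ce p).1 i) (ce p).2).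
  move=> -[p Up]; have Uq : oset U' (comap proj0 p) by rewrite /= comap_phiK.
  have [W [b [g [Wq sE]]]] := spec_valP s (exist _ _ Uq).
  have [c [e cE]] := frac_ev_surj b g.
  exists (preim (comap_cont proj0) W), (c i), e; split=> //.
  move=> [p' Up'] /= Wp'.
  have Uq' : oset U' (comap proj0 p') by rewrite /= comap_phiK.
  have [hg sE'] := sE (exist _ _ Uq') Wp'; have [he ceE] := cE _ hg.
  rewrite comap_phiK in he; split=> //.
  have [he' sE''] := ceP (exist _ _ Up').
  apply: (frac_ev_inj (q := comap proj0 p')) => //; first exact: comap_phiK.
  rewrite ceE -sE' (sE'' (exist _ _ Uq')) //=; exact: comap_phiK.
exists [ffun i => SpecSec (tP i)]; apply: spec_sec_ext => q.
pose p : pts U := exist _ (comap phi (sval q)) (proj2_sig q).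
have [he sE] := ceP p; rewrite (sE q erefl); apply: affine_sec_val => // i.
by rewrite ffunE.
Qed.

Lemma affine_sec_bij : bijective affine_sec.
Proof.
have [g gK] := choice affine_sec_surj.
by exists g => // s; apply: affine_sec_inj; rewrite gK.
Qed.

End Sections.

End AffineThick.

(** * Inverses of isomorphisms *)

Lemma rmorphism_inv (R S : comPzRingType) (f : {rmorphism R -> S}) :
  bijective f -> exists g : {rmorphism S -> R}, cancel f g /\ cancel g f.
Proof.
move=> [g fK gK].
have gz : zmod_morphism g.
  by move=> a b; rewrite -[a]gK -[b]gK -rmorphB !fK.
have gm : monoid_morphism g.
  split=> [|a b]; first by rewrite -(rmorph1 f) fK.
  by rewrite -[a]gK -[b]gK -rmorphM !fK.
by exists (HB.pack g (GRing.isZmodMorphism.Build _ _ _ gz)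
  (GRing.isMonoidMorphism.Build _ _ _ gm) : {rmorphism S -> R}).
Qed.

Section InverseMorphism.
Variables (X Y : ringed_space) (f : mor X Y).
Hypotheses (f_oi : open_immersion f) (f_surj : forall y, range f y).

Lemma mor_inv_fun : exists2 g : Y -> X, cancel f g & cancel g f.
Proof.
have surj y : exists x, f x = y by have [x _ e] := f_surj y; exists x.
have [g gK] := choice surj; exists g => // x.
by case: f_oi => inj _ _; apply: inj; rewrite gK.
Qed.

Variables (g : Y -> X) (fK : cancel f g) (gK : cancel g f).

Lemma mor_inv_cont (U : set X) : open U -> open (g @^-1` U).
Proof.
move=> oU; have -> : g @^-1` U = f @` U; last by case: f_oi => _ + _; apply.
apply/seteqP; split=> [y Uy|_ [x Ux <-]]; last by rewrite /= fK.
by exists (g y).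
Qed.

Lemma mor_inv_sub (U : opens X) :
  preim (mor_cont f) (preim mor_inv_cont U) `<=` U.
Proof. by move=> x /=; rewrite fK. Qed.

Lemma mor_inv_sec_ex (V : opens Y) :
  exists h : {rmorphism sec (preim (mor_cont f) V) -> sec V},
    cancel (mor_sec f V) h /\ cancel h (mor_sec f V).
Proof.
apply: rmorphism_inv; case: f_oi => _ _; apply=> y _; exact: f_surj.
Qed.

Let inv_sec V := sval (cid (mor_inv_sec_ex V)).

Let inv_secK V : cancel (inv_sec V) (mor_sec f V).
Proof. exact: (svalP (cid (mor_inv_sec_ex V))).2. Qed.

Let mor_sec_inj V : injective (mor_sec f V).
Proof. exact: can_inj (svalP (cid (mor_inv_sec_ex V))).1. Qed.

(** The open sets [U] and [preim (mor_cont f) (preim mor_inv_cont U)] have the same points but are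
    not convertible, so a restriction takes the place of a cast. *)
Definition mor_inv_sec (U : opens X) :
    {rmorphism sec U -> sec (preim mor_inv_cont U)} :=
  inv_sec (preim mor_inv_cont U) \o res (@mor_inv_sub U).

Lemma mor_sec_inv (U : opens X) (W : opens Y) (W' : opens X)
    (h : W `<=` preim mor_inv_cont U)
    (h' : W' `<=` preim (mor_cont f) W) (h'' : W' `<=` U) s :
  res h' (mor_sec f W (res h (mor_inv_sec U s))) = res h'' s.
Proof.
have h1 : preim (mor_cont f) W `<=`
  preim (mor_cont f) (preim mor_inv_cont U) by move=> x /h.
have h2 : W' `<=` preim (mor_cont f) (preim mor_inv_cont U) by move=> x /h'/h1.
by rewrite -(mor_res _ h1) (res_comp _ _ h2) inv_secK (res_comp _ _ h'').
Qed.

Lemma mor_inv_res (U V : opens X) (h : V `<=` U)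
    (h' : preim mor_inv_cont V `<=` preim mor_inv_cont U) (s : sec U) :
  res h' (mor_inv_sec U s) = mor_inv_sec V (res h s).
Proof.
apply: mor_sec_inj; rewrite inv_secK.
have hV : preim (mor_cont f) (preim mor_inv_cont V) `<=` U.
  by move=> x /mor_inv_sub /h.
rewrite -[LHS](res_id (fun x => id)) (mor_sec_inv _ _ hV).
by rewrite (res_comp _ _ hV).
Qed.

Lemma mor_inv_local (y : Y) (V : opens X) (s : sec V) : oset V (g y) ->
  germ_unit y (mor_inv_sec V s) -> germ_unit (g y) s.
Proof.
move=> Vy [W [h [t [Wy e]]]].
have h' : preim (mor_cont f) W `<=` V by move=> x /h; rewrite /= fK.
exists (preim (mor_cont f) W), h', (mor_sec f W t); split.
  by rewrite /= gK.
rewrite -(mor_sec_inv h (fun x => id)) res_id -rmorphM e; exact: rmorph1.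
Qed.

Definition mor_inv : mor Y X :=
  @Mor Y X g mor_inv_cont mor_inv_sec mor_inv_res mor_inv_local.

Lemma mor_invK : compm mor_inv f = idm X.
Proof.
apply: mor_ext => [x|V W hf hg s] /=; first exact: fK.
by rewrite inv_secK (res_comp _ _ hg).
Qed.

Lemma mor_invV : compm f mor_inv = idm Y.
Proof.
apply: mor_ext => [y|V W hf hg s] /=; first exact: gK.
apply: mor_sec_inj.
have h1 : preim (mor_cont f) W `<=` preim (mor_cont f) V by move=> x /hg.
rewrite -[RHS](mor_res _ h1) -[LHS](res_id (fun x => id)).
exact: mor_sec_inv.
Qed.

End InverseMorphism.

Lemma iso_inv (X Y : ringed_space) (f : mor X Y) :
  open_immersion f -> (forall y, range f y) ->
  exists g : mor Y X, compm g f = idm X /\ compm f g = idm Y.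
Proof.
move=> oi surj.
have [g fK gK] := mor_inv_fun oi surj; exists (mor_inv oi surj fK gK).
by split; [exact: mor_invK | exact: mor_invV].
Qed.

(** * Products with the disc *)

Lemma comap_homeo n (A B : comPzRingType) (phi : {rmorphism A -> B}) (tau : B)
    (rho : {rmorphism B -> tpoly n A}) :
  tau ^+ n.+1 = 0 ->
  (forall b, ev phi tau (rho b) = b) -> (forall a, rho (ev phi tau a) = a) ->
  [/\ injective (comap phi), forall p, range (comap phi) p &
     forall U : set (spec_space B), open U ->
       open ((comap phi : spec_space B -> spec_space A) @` U)].
Proof.
move=> tau_nilp rhoK evK; split=> [q q' E|p|U oU].
- by rewrite -[q](comap_projK tau_nilp rhoK) E (comap_projK tau_nilp rhoK).
- by exists (comap (proj0 rho) p) => //; apply: (comap_phiK evK).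
have -> : (comap phi : spec_space B -> spec_space A) @` U =
    (comap (proj0 rho) : spec_space A -> spec_space B) @^-1` U.
  apply/seteqP; split=> [_ [q Uq <-]|p Up] /=.
    by rewrite (comap_projK tau_nilp rhoK).
  by exists (comap (proj0 rho) p) => //; apply: (comap_phiK evK).
exact: comap_cont.
Qed.

Lemma affine_thick_iso n (A B : comPzRingType) (phi : {rmorphism A -> B})
    (tau : B) (tau_nilp : tau ^+ n.+1 = 0) (rho : {rmorphism B -> tpoly n A}) :
  (forall b, ev phi tau (rho b) = b) -> (forall a, rho (ev phi tau a) = a) ->
  exists g : mor (thick n (Spec A)) (Spec B),
    compm g (affine_thick phi tau_nilp) = idm _ /\
    compm (affine_thick phi tau_nilp) g = idm _.
Proof.
move=> rhoK evK; have [inj surj opn] := comap_homeo tau_nilp rhoK evK.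
apply: iso_inv => //; split=> // V _.
exact: (affine_sec_bij tau_nilp rhoK evK V).
Qed.

(** A chart Spec A of [X] gives the chart Spec A[t]/(t^(n+1)). On sections it is the comorphism of
    the old chart, applied to coefficients, followed by the bijection [affine_sec_bij]. *)
Lemma thick_affine n (X : scheme) (x : thick n X) :
  exists (B : comPzRingType) (j : mor (Spec B) (thick n X)),
    open_immersion j /\ range j x.
Proof.
have [A [j [[jinj jopen jsec] [p _ jp]]]] := sch_affine x.
pose phi : {rmorphism A -> tpoly n A} := @tconst n A.
have tau_nilp := tvar_nilp n A.
have evid a : ev phi (tvar n A) a = a by apply: ev_id.
pose rho : {rmorphism tpoly n A -> tpoly n A} := idfun.
have [inj surj opn] := comap_homeo (rho := rho) tau_nilp evid evid.
exists (tpoly n A), (hom_thick (compm j (Spec_mor phi)) (const_nilp tau_nilp)).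
split; last first.
  by have [q _ qp] := surj p; exists q => //=; rewrite qp.
split=> [q q' /jinj/inj //|U /opn/jopen|V Vj].
  by rewrite image_comp.
have jV : oset V `<=` range j by move=> y /Vj [q _ <-]; exists (comap phi q).
have tbij := tmap_bij n (jsec V jV).
have bij := affine_sec_bij tau_nilp (rho := rho) evid evid
  (preim (mor_cont j) V).
apply: (eq_bij (bij_comp bij tbij)) => s /=.
by rewrite /ev; apply: eq_bigr => i _; rewrite ffunE.
Qed.

Definition thick_scheme n (X : scheme) : scheme :=
  Scheme (@thick_locally_ringed n X (@sch_local X)) (@thick_affine n X).

Lemma comp1m (X Y : ringed_space) (f : mor X Y) : compm (idm Y) f = f.
Proof. by apply: mor_ext => // V W hf hg s /=; apply: res_irr. Qed.

Lemma khom_ext (k : comPzRingType) (X Y : kscheme k) (f g : khom X Y) :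
  khom_mor f = khom_mor g -> f = g.
Proof.
case: f g => [f fP] [g gP] /= e; subst g; congr KHom; exact: Prop_irrelevance.
Qed.

Lemma pullback_tvar_nilp m (T X : ringed_space) (h : mor T (thick m X)) :
  pullback h (tvar m _) ^+ m.+1 = 0.
Proof.
have e := tvar_nilp m (sec (openT_ : opens X)).
by rewrite /pullback -!rmorphXn e /= !rmorph0.
Qed.

Section Product.
Variables (k : comNzRingType) (m : nat).
Notation D := (trunc_poly k m).

Definition disc_coefs (p : D) : tpoly m k :=
  [ffun i : 'I_m.+1 => (p : {poly k})`_i].

Definition disc_var : D := in_qpoly 'X^(m.+1) 'X.

Lemma disc_var_nilp : disc_var ^+ m.+1 = 0.
Proof.
rewrite /disc_var -rmorphXn; apply: val_inj => /=.
by rewrite mk_monic_Xn Pdiv.RingMonic.rmodpp ?monicXn.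
Qed.

Lemma ev_disc (a : tpoly m k) :
  ev (trunc_const k m) disc_var a = \poly_(i < m.+1) a (inord i) :> {poly k}.
Proof.
rewrite -[RHS](in_qpoly_small (h := 'X^(m.+1))); last first.
  by rewrite mk_monic_Xn size_polyXn ltnS size_poly.
congr (val _); rewrite poly_def rmorph_sum /ev; apply: eq_bigr => i _.
rewrite inord_val -mul_polyC rmorphM rmorphXn; congr (_ * _).
apply: val_inj => /=; rewrite mk_monic_Xn /=.
by rewrite Pdiv.CommonRing.rmodp_small // size_polyC size_polyXn; case: eqP.
Qed.

Lemma ev_disc_bij : bijective (ev_rmor (trunc_const k m) disc_var_nilp).
Proof.
exists disc_coefs => [a|p].
  by apply/ffunP => i; rewrite ffunE ev_disc coef_poly ltn_ord inord_val.
apply: val_inj; rewrite [LHS]ev_disc; apply/polyP => i; rewrite coef_poly.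
case: ltnP => [lt|ge]; first by rewrite ffunE inordK.
rewrite nth_default //; apply: leq_trans ge.
rewrite -ltnS; apply: leq_trans (size_mk_monic p) _.
by rewrite mk_monic_Xn size_polyXn.
Qed.

(** Identifies the disc with the thickening of Spec k, so that morphisms to the disc are described
    by the image of t. *)
Definition disc_mor : mor (Spec D) (thick m (Spec k)) :=
  affine_thick (trunc_const k m) disc_var_nilp.

Lemma disc_iso : exists g : mor (thick m (Spec k)) (Spec D),
  compm g disc_mor = idm _ /\ compm disc_mor g = idm _.
Proof.
have [rho [evK rhoK]] := rmorphism_inv ev_disc_bij.
exact: (affine_thick_iso disc_var_nilp rhoK evK).
Qed.

Variable X : kscheme k.

Definition thick_kscheme : kscheme k :=
  @KScheme k (thick_scheme m X) (compm (kstr X) (thick_proj m X)).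

Definition thick_khom : khom thick_kscheme X :=
  @KHom k thick_kscheme X (thick_proj m X) erefl.

(* The base change of [kstr X] along [Spec Z[t]/(t^(m+1))]. *)
Definition thick_str : mor (thick m X) (thick m (Spec k)) :=
  hom_thick (compm (kstr X) (thick_proj m X)) (tvar_nilp m _).

Lemma thick_str_proj :
  compm (thick_proj m (Spec k)) thick_str = compm (kstr X) (thick_proj m X).
Proof. exact: hom_thick_proj. Qed.

Lemma thick_str_var : pullback thick_str (tvar m _) = tvar m _.
Proof. exact: pullback_hom_thick. Qed.

Lemma disc_mor_proj :
  compm (thick_proj m (Spec k)) disc_mor = Spec_mor (trunc_const k m).
Proof. exact: hom_thick_proj. Qed.

(** A morphism [b] over k to the disc is determined by the section [tau] to which it pulls back t,
    its component to Spec k being the structure morphism. Hence pairs (a, b) correspond to pairs (a,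
    tau), that is, to morphisms into the thickening. *)
Lemma kprod_exists : inhabited (kprod X (jet_disc k m)).
Proof.
have [g [gj jg]] := disc_iso.
have pr2_over : compm (kstr (jet_disc k m)) (compm g thick_str) =
    kstr thick_kscheme.
  rewrite /= -disc_mor_proj -compmA [compm disc_mor _]compmA jg comp1m.
  exact: thick_str_proj.
pose pr2 := @KHom k thick_kscheme (jet_disc k m) _ pr2_over.
have jpr2 : compm disc_mor pr2 = thick_str by rewrite /= compmA jg comp1m.
suff univ (T : kscheme k) (a : khom T X) (b : khom T (jet_disc k m)) :
    exists! h : khom T thick_kscheme,
      kcomp thick_khom h = a /\ kcomp pr2 h = b.
  exact: inhabits (KProd univ).
pose tau := pullback (compm disc_mor b) (tvar m _).
pose h := hom_thick a (pullback_tvar_nilp (compm disc_mor b)).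
have proj_h : compm (thick_proj m X) h = a by exact: hom_thick_proj.
have var_h : pullback h (tvar m _) = tau by exact: pullback_hom_thick.
have h_over : compm (kstr thick_kscheme) h = kstr T.
  by rewrite /= -compmA proj_h khom_over.
(* Both composites project to [kstr T] on Spec k, so by [thick_hom_ext] they agree as soon as they
   agree on t. *)
have str_b (h' : mor T (thick m X)) : compm (thick_proj m X) h' = a ->
    compm thick_str h' = compm disc_mor b <-> pullback h' (tvar m _) = tau.
  move=> e; split=> [e'|e'].
    by rewrite /tau -e' pullback_comp thick_str_var.
  apply: thick_hom_ext; last by rewrite pullback_comp thick_str_var.
  rewrite !compmA thick_str_proj disc_mor_proj -compmA e khom_over.
  exact: esym (khom_over b).
exists (@KHom k T thick_kscheme h h_over); split=> [|h' [e1 e2]].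
  split; apply: khom_ext => //=.
  rewrite -compmA; have /(str_b _ proj_h) -> := var_h.
  by rewrite compmA gj comp1m.
have p1 : compm (thick_proj m X) h' = a by rewrite -e1.
have p2 : pullback h' (tvar m _) = tau.
  apply/(str_b _ p1); rewrite -e2 -[RHS]/(compm disc_mor (compm pr2 h')).
  by rewrite compmA jpr2.
apply: khom_ext; apply: thick_hom_ext; first by rewrite proj_h p1.
by rewrite p2.
Qed.

End Product.

(** * Constant jets *)

Section JetRetract.
Variable k : comNzRingType.

Lemma kcompA (X Y Z T : kscheme k) (h : khom Z T) (g : khom Y Z)
    (f : khom X Y) :
  kcomp h (kcomp g f) = kcomp (kcomp h g) f.
Proof. by apply: khom_ext; apply: compmA. Qed.

Lemma kcomp1k (X Y : kscheme k) (f : khom X Y) : kcomp (kid Y) f = f.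
Proof. by apply: khom_ext; apply: comp1m. Qed.

Lemma kcompk1 (X Y : kscheme k) (f : khom X Y) : kcomp f (kid X) = f.
Proof. by apply: khom_ext; apply: compm1. Qed.

Lemma kprod_ext (X Y T : kscheme k) (P : kprod X Y) (u v : khom T P) :
  kcomp (kpr1 P) u = kcomp (kpr1 P) v -> kcomp (kpr2 P) u = kcomp (kpr2 P) v ->
  u = v.
Proof.
move=> e1 e2.
have [w [_ wP]] := kprod_univ P (kcomp (kpr1 P) v) (kcomp (kpr2 P) v).
by rewrite -(wP u) // -(wP v).
Qed.

Lemma kprod_map_exists (X X' Y Y' : kscheme k) (P : kprod X Y)
    (P' : kprod X' Y') (u : khom X X') (v : khom Y Y') :
  exists w : khom P P', is_kprod_map u v w.
Proof.
have [w [wP _]] := kprod_univ P' (kcomp u (kpr1 P)) (kcomp v (kpr2 P)).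
by exists w.
Qed.

(* The point t = 0, pulled back along every structure morphism. *)
Lemma disc_origin (m : nat) :
  exists o : forall X : kscheme k, khom X (jet_disc k m),
  forall (X Y : kscheme k) (f : khom X Y), kcomp (o Y) f = o X.
Proof.
have [g [_ jg]] := disc_iso k m.
have zero_nilp : (0 : sec (openT_ : opens (Spec k))) ^+ m.+1 = 0.
  by rewrite exprS mul0r.
pose s := compm g (hom_thick (idm (Spec k)) zero_nilp).
have s_over : compm (Spec_mor (trunc_const k m)) s = idm (Spec k).
  rewrite -disc_mor_proj /s -compmA [compm (disc_mor k m) _]compmA jg comp1m.
  exact: hom_thick_proj.
have o_over (X : kscheme k) :
    compm (kstr (jet_disc k m)) (compm s (kstr X)) = kstr X.
  by rewrite compmA s_over comp1m.
exists (fun X => @KHom k X (jet_disc k m) _ (o_over X)) => X Y f.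
by apply: khom_ext; rewrite /= -compmA khom_over.
Qed.

Section Level.
Variables (m : nat) (X Y : kscheme k) (f : khom X Y).
Variables (JX : jet_scheme m X) (JY : jet_scheme m Y).
Variables (PX : kprod X (jet_disc k m)) (PY : kprod Y (jet_disc k m)).

(* The projection [Z x D -> Z] is the jet that is constant in t. *)
Definition constant_jets (Z : kscheme k) (J : jet_scheme m Z)
  (P : kprod Z (jet_disc k m)) (s : khom Z J) := jet_of P s = kpr1 P.

Lemma constant_jets_exist (Z : kscheme k) (J : jet_scheme m Z)
    (P : kprod Z (jet_disc k m)) : exists s : khom Z J, constant_jets P s.
Proof.
by have [g _ gK] := jet_of_bij J P; exists (g (kpr1 P)); apply: gK.
Qed.

Variables (fm : khom JX JY) (fmP : is_jet_map f fm).
Variables (sX : khom X JX) (sY : khom Y JY).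
Hypotheses (sXP : constant_jets PX sX) (sYP : constant_jets PY sY).

(** Both sides correspond to the jet [kcomp f (kpr1 PX)]: the left by definition of the induced map,
    the right by naturality of jets along [f]. *)
Lemma constant_jets_map : kcomp fm sX = kcomp sY f.
Proof.
apply: (bij_inj (jet_of_bij JY PX)).
have [w wP] := kprod_map_exists PX PY f (kid (jet_disc k m)).
rewrite fmP sXP (jet_of_nat (j := JY) wP) sYP; exact: esym wP.1.
Qed.

(* A jet on Y with values in X restricts, at t = 0, to a morphism Y -> X. *)
Lemma jet_retract (h : khom Y JX) :
  kcomp fm h = sY -> kcomp h f = sX -> is_iso f.
Proof.
move=> hY hX; have [o oP] := disc_origin m.
(* [zX] and [zY] embed [X] and [Y] as the locus t = 0; [zf] says that [f] and its base change [w]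
   respect these embeddings. *)
have [zX [[zX1 zX2] _]] := kprod_univ PX (kid X) (o X).
have [zY [[zY1 zY2] _]] := kprod_univ PY (kid Y) (o Y).
have [w wP] := kprod_map_exists PX PY f (kid (jet_disc k m)).
have zf : kcomp zY f = kcomp w zX.
  apply: kprod_ext; rewrite !kcompA ?zY1 ?zY2 ?wP.1 ?wP.2.
    by rewrite -kcompA zX1 kcomp1k kcompk1.
  by rewrite -kcompA zX2 oP kcomp1k.
(* The inverse is the jet [h] at t = 0. Composed with [f] on either side it becomes a constant jet
   at t = 0, which is the identity. *)
exists (kcomp (jet_of PY h) zY); split.
  rewrite -kcompA zf kcompA -(jet_of_nat (j := JX) wP) hX.
  by rewrite (sXP : jet_of PX sX = _) zX1.
by rewrite kcompA -fmP hY (sYP : jet_of PY sY = _) zY1.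
Qed.

End Level.

(** The projection to [Z] stays a projection when the disc is replaced by a smaller one. The
    constant jets of all levels are therefore compatible and define a morphism to the arc space in
    [constant_arcs]. *)
Lemma constant_jets_trunc (Z : kscheme k) (m m' : nat) (le : (m' <= m)%N)
    (J : jet_scheme m Z) (J' : jet_scheme m' Z) (P : kprod Z (jet_disc k m))
    (P' : kprod Z (jet_disc k m')) (pi : khom J J') (s : khom Z J)
    (s' : khom Z J') :
  is_truncation le pi -> constant_jets P s -> constant_jets P' s' ->
  kcomp pi s = s'.
Proof.
move=> piP sP s'P; apply: (bij_inj (jet_of_bij J' P')).
have [w wP] := kprod_map_exists P' P (kid Z) (jet_disc_incl k le).
by rewrite (piP _ P P' w wP) sP s'P wP.1 kcomp1k.
Qed.

Lemma constant_arcs (Z : kscheme k) (A : arc_space Z)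
    (P : forall m, kprod Z (jet_disc k m)) :
  exists s : khom Z A, forall m, constant_jets (P m) (kcomp (arc_proj A m) s).
Proof.
pose c m := sval (cid (constant_jets_exist (arc_jet A m) (P m))).
have cP m : constant_jets (P m) (c m) :=
  svalP (cid (constant_jets_exist (arc_jet A m) (P m))).
have [s [sP _]] := arc_univ (a := A) (c := c)
  (fun m m' lt =>
    constant_jets_trunc (@arc_truncP _ _ A _ _ lt) (cP m) (cP m')).
by exists s => m; rewrite sP.
Qed.

Lemma arc_ext (Z T : kscheme k) (A : arc_space Z) (u v : khom T A) :
  (forall m, kcomp (arc_proj A m) u = kcomp (arc_proj A m) v) -> u = v.
Proof.
move=> e; have [m m' lt|w [_ wP]] :=
  arc_univ (a := A) (c := fun m => kcomp (arc_proj A m) v).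
  by rewrite kcompA arc_projP.
by rewrite -(wP u) // -(wP v).
Qed.

End JetRetract.

Theorem corollary3p2 (k : closedFieldType) (X Y : kscheme k)
    (hX : finite_type X) (hY : finite_type Y) (f : khom X Y) (m : option nat)
    (Xm : jet_space m X) (Ym : jet_space m Y)
    (fm : khom (jet_space_obj Xm) (jet_space_obj Ym))
    (hfm : is_induced f fm) :
  is_iso fm -> is_iso f.
Proof.
have P (Z : kscheme k) i : kprod Z (jet_disc k i).
  by apply: inhabited_witness; apply: kprod_exists.
case: m Xm Ym fm hfm => [m|] Xm Ym fm /= hfm [g [gf fg]].
  have [sX sXP] := constant_jets_exist Xm (P X m).
  have [sY sYP] := constant_jets_exist Ym (P Y m).
  apply: (jet_retract hfm sXP sYP (h := kcomp g sY)).
    by rewrite kcompA fg kcomp1k.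
  by rewrite -kcompA -(constant_jets_map hfm sXP sYP) kcompA gf kcomp1k.
case: hfm => fj [fjP fmP].
have [sX sXP] := constant_arcs Xm (P X).
have [sY sYP] := constant_arcs Ym (P Y).
have fs : kcomp fm sX = kcomp sY f.
  apply: arc_ext => i; rewrite [LHS]kcompA fmP -[LHS]kcompA [RHS]kcompA.
  exact: (constant_jets_map (fjP i) (sXP i) (sYP i)).
(* The inverse is taken on arc spaces, and only its result is projected to level 0; both identities
   required of [h] are projections of identities between arcs. *)
apply: (jet_retract (fjP 0) (sXP 0) (sYP 0)
  (h := kcomp (arc_proj Xm 0) (kcomp g sY))).
  by rewrite [LHS]kcompA -fmP -[LHS]kcompA [kcomp fm _]kcompA fg kcomp1k.
by rewrite -!kcompA -fs [kcomp g _]kcompA gf kcomp1k.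
Qed.
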